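(* Let $1<\alpha<2$, $\lambda\ge0$, $K\ge0$, and let $u$ be the exact, sufficiently regular solution of $$\frac{\partial u}{\partial t}=K\,{}_aD_x^{\alpha,\lambda}u+f\ \text{ on }(a,b)\times(0,T],\qquad u(x,0)=u_0(x),\quad u(a,t)=0,\quad u(b,t)=u_b(t).$$ Let $h=(b-a)/M$, $\tau=T/N$ with $M,N$ positive integers, $x_i=a+ih$, $t_n=n\tau$, and let $U_i^n$ be the solution of the finite difference scheme $${}_{L}\mathcal{B}U_i^{n+1}-K\tau\,{}_{L}\tilde D_h^{\alpha,\lambda}U_i^{n+1}={}_{L}\mathcal{B}U_i^n+\tau\,{}_{L}\mathcal{B}f_i^{n+1},\quad 1\le i\le M-1,\ 0\le n\le N-1,$$ with $U_i^0=u_0(x_i)$, $U_0^n=0$, $U_M^n=u_b(t_n)$ and $f_i^n=f(x_i,t_n)$. Then, with $u^n=(u(x_i,t_n))_i$, $$\|u^n-U^n\|\le C(\tau+h^3)\qquad\text{for all }1\le n\le N,$$ where $C$ is a constant independent of $n$, $\tau$ and $h$.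
   Context: ${}_aD_x^{\alpha,\lambda}u(x)=\frac{e^{-\lambda x}}{\Gamma(2-\alpha)}\frac{d^2}{dx^2}\int_a^x(x-s)^{1-\alpha}e^{\lambda s}u(s)ds-\lambda^\alpha u(x)-\alpha\lambda^{\alpha-1}u'(x)$. For a grid function $V$: ${}_{L}\mathcal{B}V_i=\frac16e^{-\lambda h}V_{i-1}+\frac23V_i+\frac16e^{\lambda h}V_{i+1}$ and $${}_{L}\tilde D_h^{\alpha,\lambda}V_i=\frac1{h^\alpha}\sum_{k=0}^{i+1}w_k^{(\alpha,\lambda)}V_{i-k+1}-\frac{\alpha\lambda^{\alpha-1}}{2h}\left(e^{\lambda h}V_{i+1}-e^{-\lambda h}V_{i-1}\right)+\lambda^\alpha(\alpha-1)\,{}_{L}\mathcal{B}V_i.$$ The weights: let $g_k^{(\alpha)}=\frac{\Gamma(k-\alpha)}{\Gamma(-\alpha)\Gamma(k+1)}$, $\mu_{-1}=\frac1{24}(4-7\alpha+3\alpha^2)$, $\mu_0=\frac1{12}(8+\alpha-3\alpha^2)$, $\mu_1=\frac1{24}(4+5\alpha+3\alpha^2)$. Then $w_0^{(\alpha,\lambda)}=\mu_1g_0^{(\alpha)}e^{\lambda h}$, $w_1^{(\alpha,\lambda)}=\mu_1g_1^{(\alpha)}+\mu_0g_0^{(\alpha)}$, and $w_k^{(\alpha,\lambda)}=(\mu_1g_k^{(\alpha)}+\mu_0g_{k-1}^{(\alpha)}+\mu_{-1}g_{k-2}^{(\alpha)})e^{(1-k)\lambda h}$ for $k\ge2$. Norm: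 $\|v\|^2=h\sum_{i=1}^{M-1}v_i^2$. ''Sufficiently regular'' (standing assumption): the solution is unique and smooth enough that the local truncation errors $R_i^{n+1}$, defined by $${}_{L}\mathcal{B}u_i^{n+1}-{}_{L}\mathcal{B}u_i^n=K\tau\,{}_{L}\tilde D_h^{\alpha,\lambda}u_i^{n+1}+\tau\,{}_{L}\mathcal{B}f_i^{n+1}+\tau R_i^{n+1},\qquad u_i^n=u(x_i,t_n),$$ satisfy $|R_i^{n+1}|\le C_1(\tau+h^3)$ with $C_1$ independent of $i,n,\tau,h$. *)

(* Defs.v *)
From HB Require Import structures.
From mathcomp Require Import all_boot all_order all_algebra.
From mathcomp Require Import all_classical all_reals all_analysis.

Set Implicit Arguments.
Unset Strict Implicit.
Unset Printing Implicit Defensive.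

Import Order.TTheory GRing.Theory Num.Theory.
Import numFieldNormedType.Exports.

Local Open Scope classical_set_scope.
Local Open Scope ring_scope.

(* Euler's integral; it is the Gamma function for x > 0. *)
Definition Euler_Gamma (R : realType) (x : R) : R :=
  \int[lebesgue_measure]_(t in `]0, +oo[) (t `^ (x - 1) * expR (- t)).

(* Continuation by Gamma(x) = Gamma(x + n) / (x (x + 1) ... (x + n - 1)), where
   n is the least natural number such that 0 < x + n (so n = 0 when 0 < x).
   The value is meaningless at the poles 0, -1, -2, ... *)
Definition Gamma (R : realType) (x : R) : R :=
  let n := Num.truncn (1 - x) in
  Euler_Gamma (x + n%:R) / \prod_(k < n) (x + k%:R).

(* x |-> int_a^x (x - s)^(1 - alpha) e^(lambda s) v(s) ds *)
Definition frac_integral (R : realType) (a alpha lambda : R) (v : R -> R)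
    (x : R) : R :=
  \int[lebesgue_measure]_(s in `[a, x])
    ((x - s) `^ (1 - alpha) * expR (lambda * s) * v s).

Definition frac_deriv (R : realType) (a alpha lambda : R) (v : R -> R)
    (x : R) : R :=
  expR (- (lambda * x)) / Gamma (2 - alpha)
    * ((frac_integral a alpha lambda v)^`(2))%classic x
  - lambda `^ alpha * v x - alpha * lambda `^ (alpha - 1) * (v^`())%classic x.

Definition frac_derivable (R : realType) (a alpha lambda : R) (v : R -> R)
    (x : R) : Prop :=
  [/\ derivable v x 1,
      (\forall y \near x, derivable (frac_integral a alpha lambda v) y 1) &
      derivable (frac_integral a alpha lambda v)^`()%classic x 1].

(* l is the derivative at t of g restricted to [0, T]; this is the ordinary
   derivative for 0 < t < T and the left derivative for t = T. *)
Definition is_time_deriv (R : realType) (T : R) (g : R -> R) (t l : R) : Prop :=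
  (g s - g t) / (s - t) @[s --> within `[0, T] t^'] --> l.

Definition is_solution (R : realType) (a b T alpha lambda K : R)
    (u0 ub : R -> R) (f u : R -> R -> R) : Prop :=
  [/\ {within `[a, b] `*` `[0, T], continuous (fun p : R * R => u p.1 p.2)},
      (forall x t : R, a < x < b -> 0 < t <= T ->
         frac_derivable a alpha lambda (u^~ t) x /\
         is_time_deriv T (u x) t
           (K * frac_deriv a alpha lambda (u^~ t) x + f x t)),
      (forall x : R, a <= x <= b -> u x 0 = u0 x),
      (forall t : R, 0 <= t <= T -> u a t = 0) &
      (forall t : R, 0 <= t <= T -> u b t = ub t)].

Definition gw (R : realType) (alpha : R) (k : nat) : R :=
  Gamma (k%:R - alpha) / (Gamma (- alpha) * Gamma (k%:R + 1)).

(* mu_{-1}, mu_0 and mu_1 *)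
Definition mum1 (R : realType) (alpha : R) : R :=
  (4 - 7 * alpha + 3 * alpha ^+ 2) / 24.
Definition mu0 (R : realType) (alpha : R) : R :=
  (8 + alpha - 3 * alpha ^+ 2) / 12.
Definition mu1 (R : realType) (alpha : R) : R :=
  (4 + 5 * alpha + 3 * alpha ^+ 2) / 24.

Definition weight (R : realType) (alpha lambda h : R) (k : nat) : R :=
  match k with
  | 0 => mu1 alpha * gw alpha 0 * expR (lambda * h)
  | 1 => mu1 alpha * gw alpha 1 + mu0 alpha * gw alpha 0
  | k'.+2 => (mu1 alpha * gw alpha k + mu0 alpha * gw alpha k'.+1
               + mum1 alpha * gw alpha k')
             * expR ((1 - k%:R) * lambda * h)
  end.

(* Grid functions are functions of the index; compact_op and discr_deriv are
   only used at interior indices, where i.-1 is the true predecessor. *)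
Definition compact_op (R : realType) (lambda h : R) (V : nat -> R)
    (i : nat) : R :=
  1 / 6 * expR (- (lambda * h)) * V i.-1 + 2 / 3 * V i
  + 1 / 6 * expR (lambda * h) * V i.+1.

Definition discr_deriv (R : realType) (alpha lambda h : R) (V : nat -> R)
    (i : nat) : R :=
  1 / h `^ alpha
    * (\sum_(0 <= k < i.+2) weight alpha lambda h k * V (i.+1 - k)%N)
  - alpha * lambda `^ (alpha - 1) / (2 * h)
    * (expR (lambda * h) * V i.+1 - expR (- (lambda * h)) * V i.-1)
  + lambda `^ alpha * (alpha - 1) * compact_op lambda h V i.

Definition gridx (R : realType) (a h : R) (i : nat) : R := a + i%:R * h.
Definition gridt (R : realType) (tau : R) (n : nat) : R := n%:R * tau.

(* Restriction of a function of (x, t) to the grid; the time level n comes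
   first, so that [sample a h tau w n] is the grid function w^n. *)
Definition sample (R : realType) (a h tau : R) (w : R -> R -> R)
    (n i : nat) : R :=
  w (gridx a h i) (gridt tau n).

Definition is_trunc_error (R : realType) (a alpha lambda K h tau : R)
    (f u : R -> R -> R) (n i : nat) (r : R) : Prop :=
  let uh := sample a h tau u in
  let fh := sample a h tau f in
  compact_op lambda h (uh n.+1) i - compact_op lambda h (uh n) i
  = K * tau * discr_deriv alpha lambda h (uh n.+1) i
    + tau * compact_op lambda h (fh n.+1) i + tau * r.

Definition sufficiently_regular (R : realType) (a b T alpha lambda K : R)
    (u0 ub : R -> R) (f u : R -> R -> R) : Prop :=
  (forall v : R -> R -> R, is_solution a b T alpha lambda K u0 ub f v ->
     forall x t : R, a <= x <= b -> 0 <= t <= T -> v x t = u x t)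
  /\
  (exists C1 : R, forall M N : nat, (0 < M)%N -> (0 < N)%N ->
     let h := (b - a) / M%:R in
     let tau := T / N%:R in
     forall (n i : nat) (r : R), (n < N)%N -> (1 <= i < M)%N ->
       is_trunc_error a alpha lambda K h tau f u n i r ->
       `|r| <= C1 * (tau + h ^+ 3)).

Definition solves_scheme (R : realType) (a alpha lambda K h tau : R)
    (u0 ub : R -> R) (f : R -> R -> R) (M N : nat) (U : nat -> nat -> R)
    : Prop :=
  let fh := sample a h tau f in
  [/\ (forall n i, (n < N)%N -> (1 <= i < M)%N ->
         compact_op lambda h (U n.+1) i
         - K * tau * discr_deriv alpha lambda h (U n.+1) i
         = compact_op lambda h (U n) i + tau * compact_op lambda h (fh n.+1) i),
      (forall i, (i <= M)%N -> U 0%N i = u0 (gridx a h i)),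
      (forall n, (n <= N)%N -> U n 0%N = 0) &
      (forall n, (n <= N)%N -> U n M = ub (gridt tau n))].

(* U is the solution of the scheme: it solves it, and on the grid it is the
   only solution.  On coarse grids (lambda h large) the linear system of a time
   step can be singular, so uniqueness is not automatic. *)
Definition is_scheme_solution (R : realType) (a alpha lambda K h tau : R)
    (u0 ub : R -> R) (f : R -> R -> R) (M N : nat) (U : nat -> nat -> R)
    : Prop :=
  solves_scheme a alpha lambda K h tau u0 ub f M N U /\
  (forall V, solves_scheme a alpha lambda K h tau u0 ub f M N V ->
     forall n i, (n <= N)%N -> (i <= M)%N -> V n i = U n i).

Definition grid_norm (R : realType) (h : R) (M : nat) (v : nat -> R) : R :=
  Num.sqrt (h * \sum_(1 <= i < M) v i ^+ 2).

(* Main.v *)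
Require Import Defs.
From HB Require Import structures.
From mathcomp Require Import all_boot all_order all_algebra.
From mathcomp Require Import all_classical all_reals all_analysis.
From mathcomp Require Import measurable_realfun.
From mathcomp Require Import ring lra.
Import Order.TTheory GRing.Theory Num.Theory.
Import numFieldNormedType.Exports.
Local Open Scope ring_scope.

(* Energy method for the error e = u - U on the grid, which vanishes at both
   ends of the interval.

   Every spatial operator is of Toeplitz type, so its quadratic form is a linear
   combination of the autocorrelations c_k = sum_i e_i e_(i+k).  For 1 < alpha < 2
   all weights w_k with k >= 4 are nonnegative; w_3 may be negative, but then
   w_0 + w_2 + 4 w_3 > 0, and c_0 - c_2 <= 4 (c_0 - c_1) absorbs it.  Hence the
   form is at most c_0 times the sum of the coefficients, that is, times the
   symbol at frequency zero.

   - If tau is small, multiply e by e^(lambda x): the compact operator becomes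
     symmetric, the centred difference skew and the fractional part nonpositive,
     so the energy grows by a factor 1 + O(tau) per step.
   - If tau is not small there are boundedly many time steps and a bounded loss
     per step is harmless.  The unweighted symbol at frequency zero is
     O((lambda h)^(alpha + 1)) / h^alpha, which tends to 0 with h, so for small h
     one step is stable whatever tau is.
   - The finitely many remaining grids are covered by the uniqueness of U. *)

(** * The Gamma function and the Gruenwald coefficients *)

Definition gamma_density {R : realType} (x t : R) : R :=
  t `^ (x - 1) * expR (- t).

Lemma gamma_density_ge0 (R : realType) (x t : R) : 0 <= gamma_density x t.
Proof. by rewrite mulr_ge0 ?powR_ge0 ?expR_ge0. Qed.

Lemma measurable_gamma_density (R : realType) (x : R) :
  measurable_fun setT (gamma_density x).
Proof.
apply: measurable_funM; first exact: measurable_powR.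
by apply: measurableT_comp => //; exact: measurableT_comp.
Qed.

(** Values are extended reals, so that limits, comparisons and the functional equation are available
    before finiteness is known. [Euler_Gamma] is its [fine]. *)
Definition euler_integral {R : realType} (x : R) : \bar R :=
  (\int[lebesgue_measure]_(t in `]0%R, +oo[) (gamma_density x t)%:E)%E.

(** Compact intervals exhausting the half-line and avoiding the singularity of the density at 0.
    Starting at 2 keeps the endpoints distinct. *)
Definition trunc_itv (R : realType) (n : nat) : set R :=
  `[(n.+2%:R)^-1, n.+2%:R]%classic.

Lemma bigcup_trunc_itv (R : realType) :
  (\bigcup_n trunc_itv R n)%classic = `]0%R, +oo[%classic :> set R.
Proof.
apply/seteqP; split=> [t [n _]|t] /=; rewrite /trunc_itv/= !in_itv/=.
  by move=> /andP[nt _]; rewrite andbT (lt_le_trans _ nt)// invr_gt0.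
rewrite andbT => t0.
have t'0 : 0 < t^-1 by rewrite invr_gt0.
pose n := (Num.truncn t + Num.truncn t^-1)%N.
exists n => //; rewrite /trunc_itv/= in_itv/=; apply/andP; split.
  rewrite -[leRHS]invrK lef_pV2 ?posrE//.
  apply: ltW; apply: lt_le_trans (truncnS_gt t^-1) _.
  by rewrite ler_nat ltnS (leq_trans (leq_addl _ _) (leqnSn _)).
apply: ltW; apply: lt_le_trans (truncnS_gt t) _.
by rewrite ler_nat ltnS (leq_trans (leq_addr _ _) (leqnSn _)).
Qed.

Lemma euler_integral_cvg (R : realType) (x : R) :
  (((\int[lebesgue_measure]_(t in trunc_itv R n) (gamma_density x t)%:E)%E)
    @[n --> \oo] --> euler_integral x)%classic.
Proof.
rewrite /euler_integral -bigcup_trunc_itv.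
apply: ge0_nondecreasing_set_cvg_integral.
- move=> n m nm; apply/subsetPset => t; rewrite /trunc_itv/= !in_itv/=.
  move=> /andP[nt tn]; apply/andP; split.
    by apply: le_trans nt; rewrite lef_pV2 ?posrE// ler_nat ltnS.
  by apply: le_trans tn _; rewrite ler_nat ltnS.
- by move=> n; exact: measurable_itv.
- move=> n; apply/measurable_EFinP; apply: measurable_funTS.
  exact: measurable_gamma_density.
- by move=> n t _; rewrite lee_fin gamma_density_ge0.
Qed.

Lemma euler_integral_ge0 (R : realType) (x : R) : (0 <= euler_integral x)%E.
Proof. by apply: integral_ge0 => t _; rewrite lee_fin gamma_density_ge0. Qed.

Lemma is_derive_continuous (R : realType) (F : R -> R) (t df : R) :
  is_derive t (1 : R) F df -> {for t, continuous F}.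
Proof.
move=> dt; apply: differentiable_continuous.
by apply/derivable1_diffP; exact: ex_derive.
Qed.

Lemma is_derive_expRN (R : realType) (t : R) :
  is_derive t (1 : R) (fun t : R => expR (- t)) (- expR (- t)).
Proof. by apply: is_derive_eq; rewrite mulrN1. Qed.

Lemma derive_oo_LRcontinuous (R : realType) (F f : R -> R) (a b : R) :
  a < b ->
  (forall t : R, a <= t <= b -> is_derive t (1 : R) F (f t)) ->
  derivable_oo_LRcontinuous F a b /\ {in `]a, b[, F^`()%classic =1 f}.
Proof.
move=> ab dF.
have cF t : a <= t <= b -> {for t, continuous F}.
  by move=> /dF; exact: is_derive_continuous.
split; first split.
- move=> t; rewrite in_itv/= => /andP[t1 t2].
  by have := dF t; rewrite !ltW// => /(_ isT) dt; exact: ex_derive.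
- by apply: cvg_at_right_filter; apply: cF; rewrite lexx ltW.
- by apply: cvg_at_left_filter; apply: cF; rewrite lexx ltW.
- move=> t; rewrite in_itv/= => /andP[t1 t2].
  by have := dF t; rewrite !ltW// => /(_ isT) dt; rewrite derive1E derive_val.
Qed.

Lemma trunc_itv_lt (R : realType) (n : nat) : (n.+2%:R)^-1 < n.+2%:R :> R.
Proof.
apply: (@lt_trans _ _ 1); last by rewrite ltr1n.
by rewrite invf_lt1// ltr1n.
Qed.

Lemma continuous_gamma_density (R : realType) (x t : R) : 0 < t ->
  {for t, continuous (gamma_density x)}.
Proof.
move=> t0; apply: continuousM.
  exact: is_derive_continuous (is_derive1_powR _ t0).
exact: is_derive_continuous (is_derive_expRN R t).
Qed.

Lemma trunc_gamma_density_integrable (R : realType) (x : R) (n : nat) :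
  (@lebesgue_measure R).-integrable (trunc_itv R n)
    (fun t => (gamma_density x t)%:E).
Proof.
apply: continuous_compact_integrable; first exact: segment_compact.
apply/subspace_continuousP => t; rewrite /trunc_itv/= in_itv/= => /andP[t1 _].
apply: cvg_within_filter; apply: continuous_gamma_density.
by apply: lt_le_trans t1; rewrite invr_gt0.
Qed.

(** Integration by parts with [t ^ x] and [- expR (- t)]; the boundary terms are kept here and
    vanish in the limit. *)
Lemma trunc_gamma_rec (R : realType) (x : R) (n : nat) :
  ((\int[lebesgue_measure]_(t in trunc_itv R n) (gamma_density (x + 1) t)%:E) =
   ((n.+2%:R^-1) `^ x * expR (- n.+2%:R^-1) - n.+2%:R `^ x * expR (- n.+2%:R))%:E
   + x%:E * \int[lebesgue_measure]_(t in trunc_itv R n)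
            (gamma_density x t)%:E)%E.
Proof.
have ab := trunc_itv_lt R n.
set a : R := n.+2%:R^-1 in ab *; set b : R := n.+2%:R in ab *.
have a0 : 0 < a by rewrite invr_gt0.
have [FLR dF] : derivable_oo_LRcontinuous (fun t : R => t `^ x) a b /\
    {in `]a, b[, ((fun t : R => t `^ x)^`())%classic =1 fun t => x * t `^ (x - 1)}.
  apply: derive_oo_LRcontinuous => // t /andP[at_ _].
  by apply: is_derive1_powR; apply: lt_le_trans at_.
have [GLR dG] : derivable_oo_LRcontinuous (fun t : R => - expR (- t)) a b /\
    {in `]a, b[, ((fun t : R => - expR (- t))^`())%classic =1 fun t => expR (- t)}.
  apply: derive_oo_LRcontinuous => // t _.
  have := is_derive_expRN R t => dt.
  by apply: is_derive_eq; rewrite opprK.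
have itv0 t : `[a, b]%classic t -> 0 < t.
  by rewrite /= in_itv/= => /andP[at_ _]; apply: lt_le_trans at_.
have := @integration_by_parts R _ _ _ _ a b ab _ FLR dF _ GLR dG.
have -> : (\int[lebesgue_measure]_(t in trunc_itv R n)
    (gamma_density (x + 1) t)%:E =
  \int[lebesgue_measure]_(t in `[a, b]) (t `^ x * expR (- t))%:E)%E.
  by apply: eq_integral => t _; rewrite /gamma_density addrK.
move=> ->.
- rewrite [X in (_ - X)%E](_ : _ =
    (\int[lebesgue_measure]_(t in `[a, b]) ((- x)%:E * (gamma_density x t)%:E))%E).
    rewrite integralZl//; last exact: trunc_gamma_density_integrable.
    rewrite /= EFinN mulNe oppeK; congr (_%:E + _)%E.
    by rewrite !mulrN opprK addrC.
  apply: eq_integral => t _; rewrite -EFinM; congr EFin.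
  by rewrite /gamma_density mulrN mulNr mulrA.
- apply/subspace_continuousP => t /itv0 t0.
  apply: cvg_within_filter; apply: cvgMr.
  exact: (is_derive_continuous _ _ _ _ (is_derive1_powR (x - 1) t0)).
- apply/subspace_continuousP => t /itv0 t0.
  apply: cvg_within_filter.
  exact: (is_derive_continuous _ _ _ _ (is_derive_expRN R t)).
Qed.


Lemma cvg_invn2 (R : realType) :
  ((n.+2%:R : R)^-1 @[n --> \oo] --> (0 : R))%classic.
Proof. by have := @cvg_harmonic R; rewrite -cvg_shiftS. Qed.

Lemma cvg_powR_invn2 (R : realType) (x : R) : 0 < x ->
  ((n.+2%:R^-1 `^ x * expR (- n.+2%:R^-1)) @[n --> \oo] --> (0 : R))%classic.
Proof.
move=> x0; apply: (@squeeze_cvgr _ _ _ _ (fun=> 0) (fun n => n.+2%:R^-1 `^ x)).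
- near=> n; rewrite mulr_ge0 ?powR_ge0 ?expR_ge0//=.
  rewrite ler_piMr ?powR_ge0// -expR0 ler_expR oppr_le0 invr_ge0//.
- exact: cvg_cst.
- apply: ((cvg_at_rightP (fun y => y `^ x) 0 0).1 (powR_cvg0 x0)); split.
    by move=> n; rewrite invr_gt0.
  exact: cvg_invn2.
Unshelve. all: by end_near. Qed.

Lemma cvg_powR_natSS (R : realType) (x : R) :
  ((n.+2%:R `^ x * expR (- n.+2%:R)) @[n --> \oo] --> (0 : R))%classic.
Proof.
(* With an integer m at least x, the exponential series gives b^(m+1) / (m+1)! <= e^b, hence b^x
   e^(-b) <= (m+1)! / b. *)
pose m := (Num.truncn x).+1.
apply: (@squeeze_cvgr _ _ _ _ (fun=> 0) (fun n => m.+1`!%:R * n.+2%:R^-1)).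
- near=> n; rewrite mulr_ge0 ?powR_ge0 ?expR_ge0//=.
  have b1 : 1 <= n.+2%:R :> R by rewrite ler1n.
  have b0 : 0 < n.+2%:R :> R by [].
  set b : R := n.+2%:R in b1 b0 *.
  have xm : x <= m%:R by apply: ltW; exact: truncnS_gt.
  have := ler_powR b1 xm; rewrite powR_mulrn; last exact: ltW.
  move=> bx.
  rewrite expRN ler_pdivrMr ?expR_gt0// mulrAC ler_pdivlMr//.
  have := expR_ge1Dxn m (ltW b0) => eb.
  have f0 : 0 < m.+1`!%:R :> R by rewrite ltr0n fact_gt0.
  have : m.+1`!%:R * (b ^+ m.+1 / m.+1`!%:R) <= m.+1`!%:R * expR b.
    rewrite ler_pM2l//; lra.
  rewrite mulrCA divff ?gt_eqF// mulr1; apply: le_trans.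
  by rewrite exprSr ler_pM2r.
- exact: cvg_cst.
- by rewrite -[X in (_ --> X)%classic](mulr0 m.+1`!%:R); apply: cvgMr; exact: cvg_invn2.
Unshelve. all: by end_near. Qed.

Lemma euler_integral_rec (R : realType) (x : R) : 0 < x ->
  (euler_integral (x + 1) = x%:E * euler_integral x)%E.
Proof.
move=> x0; suff lim : (((\int[lebesgue_measure]_(t in trunc_itv R n)
    (gamma_density (x + 1) t)%:E)%E) @[n --> \oo] -->
    (x%:E * euler_integral x)%E)%classic.
  by apply: (cvg_unique _ (euler_integral_cvg _ _) lim).
rewrite (funext (trunc_gamma_rec R x)).
rewrite -[X in (_ --> X)%classic]add0e; apply: cvgeD.
- by rewrite fin_num_adde_defr.
- apply: cvg_EFin; first exact: nearW.
  rewrite -[X in (_ --> X)%classic](subrr 0); apply: cvgB.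
    exact: cvg_powR_invn2.
  exact: cvg_powR_natSS.
- apply: cvgeZl => //; exact: euler_integral_cvg.
Qed.

Lemma euler_integral1 (R : realType) : euler_integral (1 : R) = 1%E.
Proof.
suff lim : (((\int[lebesgue_measure]_(t in trunc_itv R n)
    (gamma_density 1 t)%:E)%E) @[n --> \oo] --> (1%E : \bar R))%classic.
  by apply: (cvg_unique _ (euler_integral_cvg _ _) lim).
have FTC n : (\int[lebesgue_measure]_(t in trunc_itv R n) (gamma_density 1 t)%:E =
    (expR (- n.+2%:R^-1) - expR (- n.+2%:R))%:E)%E.
  have ab := trunc_itv_lt R n.
  set a : R := n.+2%:R^-1 in ab *; set b : R := n.+2%:R in ab *.
  have [GLR dG] : derivable_oo_LRcontinuous (fun t : R => - expR (- t)) a b /\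
    {in `]a, b[, ((fun t : R => - expR (- t))^`())%classic =1 fun t => expR (- t)}.
    apply: derive_oo_LRcontinuous => // t _.
    have := is_derive_expRN R t => dt.
    by apply: is_derive_eq; rewrite opprK.
  have := continuous_FTC2 ab _ GLR dG.
  rewrite -EFinB opprK addrC => <-.
    by apply: eq_integral => t _; rewrite /gamma_density subrr powRr0 mul1r.
  apply/subspace_continuousP => t _; apply: cvg_within_filter.
  exact: (is_derive_continuous _ _ _ _ (is_derive_expRN R t)).
rewrite (funext FTC).
apply: cvg_EFin; first exact: nearW.
rewrite -[X in (_ --> X)%classic](subr0 1); apply: cvgB.
  have c0 := is_derive_continuous _ _ _ _ (is_derive_expRN R 0).
  have := cvg_comp _ _ (@cvg_invn2 R) c0.
  by rewrite oppr0 expR0.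
have := @cvg_powR_natSS R 0.
by rewrite (_ : (fun n => _) = (fun n : nat => expR (- n.+2%:R)))//;
  apply/funext => n; rewrite powRr0 mul1r.
Qed.

(** A list on the right serves both bounds of [euler_integral_12]: the value at p + 1 from above by
    those at 1 and 2, and the value at 2 from above by those at p + 1 and p + 2. *)
Lemma le_euler_integral (R : realType) (x : R) (ys : seq R) :
  (forall t : R, 0 < t ->
     gamma_density x t <= \sum_(y <- ys) gamma_density y t) ->
  (euler_integral x <= \sum_(y <- ys) euler_integral y)%E.
Proof.
move=> le_xy; rewrite /euler_integral -ge0_integral_sum//=.
- apply: ge0_le_integral => //.
  + by move=> t _; rewrite lee_fin gamma_density_ge0.
  + apply/measurable_EFinP; apply: measurable_funTS.
    exact: measurable_gamma_density.
  + apply: emeasurable_sum => y; apply/measurable_EFinP.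
    apply: measurable_funTS; exact: measurable_gamma_density.
  + move=> t; rewrite /= in_itv/= andbT => t0.
    by rewrite sumEFin lee_fin le_xy.
- move=> y; apply/measurable_EFinP.
  apply: measurable_funTS; exact: measurable_gamma_density.
- by move=> y t _; rewrite lee_fin gamma_density_ge0.
Qed.

Lemma euler_integral2 (R : realType) : euler_integral (1 + 1 : R) = 1%E.
Proof. by rewrite euler_integral_rec// euler_integral1 mule1. Qed.

(* On ]1, 2[ the integral is compared with its values at 1 and 2; the lower
   bound uses t <= t^p + t^(p+1) and the functional equation. *)
Lemma euler_integral_12 (R : realType) (p : R) : 0 < p < 1 ->
  (0 < euler_integral (p + 1)%R < +oo)%E.
Proof.
move=> /andP[p0 p1]; have p10 : 0 < p + 1 by rewrite addr_gt0.
have up : (euler_integral (p + 1)%R < +oo)%E.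
  apply: (@le_lt_trans _ _ (\sum_(y <- [:: 1; 1 + 1]%R) euler_integral y)%E).
    apply: le_euler_integral => t t0.
    rewrite !big_cons big_nil addr0 /gamma_density -mulrDl ler_wpM2r ?expR_ge0//.
    rewrite !addrK subrr powRr0 powRr1; last exact: ltW.
    have [t1|t1] := leP 1 t.
      apply: (@le_trans _ _ (t `^ 1)); first by rewrite ler_powR// ltW.
      by rewrite powRr1 ?(ltW t0)// lerDr.
    apply: (@le_trans _ _ 1); last by rewrite lerDl ltW.
    by rewrite -[leRHS](powRr0 t); apply: ger_powR; rewrite ?t0 ltW.
  by rewrite !big_cons big_nil adde0 euler_integral1 euler_integral2 ltry.
rewrite up andbT lt0e euler_integral_ge0 andbT; apply/eqP => ep.
have : (euler_integral (1 + 1 : R)%R <=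
    \sum_(y <- [:: p + 1; p + 1 + 1]%R) euler_integral y)%E.
  apply: le_euler_integral => t t0.
  rewrite !big_cons big_nil addr0 /gamma_density -mulrDl ler_wpM2r ?expR_ge0//.
  rewrite !addrK.
  have [t1|t1] := leP 1 t.
    apply: (@le_trans _ _ (t `^ (p + 1))); last by rewrite lerDr powR_ge0.
    by rewrite ler_powR// lerDr ltW.
  apply: (@le_trans _ _ (t `^ p)); last by rewrite lerDl powR_ge0.
  by rewrite powRr1 ?(ltW t0)//; apply: ger1_powR; rewrite ?t0 ltW.
rewrite euler_integral2 !big_cons big_nil adde0 (euler_integral_rec _ (p + 1))//.
by rewrite ep mule0 adde0 leNgt lte01.
Qed.

Lemma Euler_GammaE (R : realType) (x : R) :
  Euler_Gamma x = fine (euler_integral x).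
Proof. by []. Qed.

Lemma Euler_Gamma_rec (R : realType) (x : R) : 0 < x ->
  Euler_Gamma (x + 1) = x * Euler_Gamma x.
Proof.
move=> x0; rewrite !Euler_GammaE euler_integral_rec//.
have := euler_integral_ge0 R x; case: (euler_integral x) => [r| |]//= _.
(* If the integral is infinite, [fine] turns both sides into 0. *)
by rewrite gt0_muley ?lte_fin//= mulr0.
Qed.

Lemma Euler_Gamma1 (R : realType) : Euler_Gamma (1 : R) = 1.
Proof. by rewrite Euler_GammaE euler_integral1. Qed.

(** The value at p + 1 is positive and finite, and it is p times the value at p. Nonvanishing allows
    Gamma(-alpha) to be cancelled in [gw]. *)
Lemma Euler_Gamma_neq0 (R : realType) (p : R) : 0 < p < 1 ->
  Euler_Gamma p != 0.
Proof.
move=> p01; have /andP[p0 _] := p01.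
have /fine_gt0 := euler_integral_12 R p p01.
rewrite -Euler_GammaE Euler_Gamma_rec// => /lt0r_neq0.
by rewrite mulf_eq0 negb_or => /andP[].
Qed.

Lemma Gamma_gt0E (R : realType) (x : R) : 0 < x -> Gamma x = Euler_Gamma x.
Proof.
move=> x0; rewrite /Gamma (_ : Num.truncn (1 - x) = 0%N).
  by rewrite big_ord0 addr0 divr1.
by apply/truncn0Pn; rewrite -ltNge; lra.
Qed.

Lemma Gamma_opp_12 (R : realType) (alpha : R) : 1 < alpha < 2 ->
  Gamma (- alpha) = Euler_Gamma (2 - alpha) / (- alpha * (1 - alpha)).
Proof.
move=> /andP[a1 a2]; rewrite /Gamma (_ : Num.truncn _ = 2%N).
  rewrite !big_ord_recl big_ord0 /= addr0 mulr1 /bump/=.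
  by rewrite (addrC _ 2) (addrC _ 1).
by apply/eqP; rewrite truncn_eq; lra.
Qed.

Lemma gwS (R : realType) (alpha : R) (k : nat) : 1 < alpha < 2 ->
  gw alpha k.+1 = gw alpha k * ((k%:R - alpha) / k.+1%:R).
Proof.
move=> a12; have /andP[a1 a2] := a12; have k0 : 0 < k.+1%:R :> R by [].
have p0 : Euler_Gamma (2 - alpha) != 0 by apply: Euler_Gamma_neq0; lra.
have G0 := Gamma_opp_12 _ _ a12.
have G1 : Gamma (1 - alpha) = Euler_Gamma (2 - alpha) / (1 - alpha).
  rewrite /Gamma (_ : Num.truncn _ = 1%N).
    rewrite !big_ord_recl big_ord0 /= addr0 mulr1.
    by rewrite (_ : 1 - alpha + 1 = 2 - alpha)//; ring.
  by apply/eqP; rewrite truncn_eq; lra.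
(* For k = 0 and k = 1 the argument k - alpha is negative and the continuation is unfolded; from k =
   2 on it is positive and Euler's functional equation applies. *)
have Gk : Gamma (k.+1%:R - alpha) = (k%:R - alpha) * Gamma (k%:R - alpha).
  case: k k0 => [|[|k]] _.
  - by rewrite sub0r G0 G1; field; lra.
  - rewrite G1 Gamma_gt0E; last lra.
    by rewrite mulrC divfK//; lra.
  - have k2 : 0 < k.+2%:R - alpha.
      by rewrite subr_gt0 (lt_le_trans a2)// ler_nat.
    have k3 : k.+3%:R - alpha = k.+2%:R - alpha + 1 by rewrite -[in LHS]natr1; ring.
    have k30 : 0 < k.+2%:R - alpha + 1 by exact: addr_gt0.
    by rewrite k3 (Gamma_gt0E _ _ k30) (Gamma_gt0E _ _ k2) Euler_Gamma_rec.
have Gn : Gamma (k.+1%:R + 1 : R) = k.+1%:R * Gamma (k%:R + 1).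
  by rewrite !natr1 !Gamma_gt0E// -[k.+2%:R]natr1 Euler_Gamma_rec.
rewrite /gw Gk Gn.
move: (Gamma (k%:R - alpha)) (Gamma (- alpha)) (Gamma (k%:R + 1)) => x y z.
by rewrite !invfM; ring.
Qed.

Lemma gw0 (R : realType) (alpha : R) : 1 < alpha < 2 -> gw alpha 0 = 1.
Proof.
move=> a12; have /andP[a1 a2] := a12.
have p0 : Euler_Gamma (2 - alpha) != 0 by apply: Euler_Gamma_neq0; lra.
have G0 := Gamma_opp_12 _ _ a12.
rewrite /gw sub0r add0r (Gamma_gt0E _ 1)// Euler_Gamma1 mulr1 divff// G0.
by rewrite mulf_neq0// invr_eq0 mulf_neq0//; lra.
Qed.

(** * The weights and their generating function *)

Lemma gw_ge0 (R : realType) (alpha : R) (k : nat) : 1 < alpha < 2 ->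
  0 <= gw alpha k.+2.
Proof.
move=> a12; have /andP[a1 a2] := a12; elim: k => [|k ih].
  by rewrite !gwS// gw0//=; nra.
rewrite gwS// mulr_ge0// divr_ge0// subr_ge0 (le_trans (ltW a2))//.
by rewrite ler_nat.
Qed.

Lemma gw_mulnS (R : realType) (alpha : R) (k : nat) : 1 < alpha < 2 ->
  k.+1%:R * gw alpha k.+1 = (k%:R - alpha) * gw alpha k.
Proof. by move=> a12; rewrite gwS//; field. Qed.

(** The sequence k g_k is nonincreasing from k = 2 on, where it equals alpha (alpha - 1). This
    bounds the remainder of the binomial series. *)
Lemma gw_muln_le (R : realType) (alpha : R) (k : nat) : 1 < alpha < 2 ->
  k.+2%:R * gw alpha k.+2 <= 2.
Proof.
move=> a12; have /andP[a1 a2] := a12; elim: k => [|k ih].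
  by rewrite !gwS// gw0//=; nra.
apply: le_trans ih; rewrite gw_mulnS// ler_wpM2r ?gw_ge0//.
by rewrite gerBl; lra.
Qed.

(** Splits off the tempering factor; [weight alpha 0 0] is from here on the untempered weight. *)
Lemma weightE (R : realType) (alpha lambda h : R) (k : nat) :
  weight alpha lambda h k
  = weight alpha 0 0 k * expR ((1 - k%:R) * (lambda * h)).
Proof.
case: k => [|[|k]] /=.
- by rewrite mulr0 expR0 mulr1 subr0 mul1r.
- by rewrite subrr mul0r expR0 mulr1.
- by rewrite !mulr0 expR0 mulr1 !mulrA.
Qed.

(** By the recurrence the weight is g_(k+2) / ((k+3)(k+4)) times a quadratic polynomial in k with
    leading coefficient mu1 + mu0 + mum1 = 1. Its other coefficients, bounded in [c0] and [c1], are
    nonnegative. *)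
Lemma weight_ge0 (R : realType) (alpha : R) (k : nat) : 1 < alpha < 2 ->
  0 <= weight alpha 0 0 k.+4.
Proof.
move=> a12; have /andP[a1 a2] := a12.
rewrite /weight !mulr0 expR0 mulr1.
have g2 := gw_ge0 R alpha k a12.
have e3 := gwS R alpha k.+2 a12; have e4 := gwS R alpha k.+3 a12.
pose x : R := k%:R.
have x0 : 0 <= x by [].
have n2 : k.+2%:R = x + 2 :> R by rewrite -addn2 natrD.
have n3 : k.+3%:R = x + 3 :> R by rewrite -addn3 natrD.
have n4 : k.+4%:R = x + 4 :> R by rewrite -addn4 natrD.
rewrite n2 n3 in e3; rewrite n3 n4 in e4.
rewrite e4 e3.
set g := gw alpha k.+2 in g2 *.
suff P : 0 <= mu1 alpha * (x + 2 - alpha) * (x + 3 - alpha)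
    + mu0 alpha * (x + 2 - alpha) * (x + 4)
    + mum1 alpha * (x + 3) * (x + 4).
  rewrite (_ : _ + _ = g / ((x + 3) * (x + 4)) *
    (mu1 alpha * (x + 2 - alpha) * (x + 3 - alpha)
    + mu0 alpha * (x + 2 - alpha) * (x + 4)
    + mum1 alpha * (x + 3) * (x + 4))); last by field; lra.
  by apply: mulr_ge0 => //; apply: divr_ge0 => //; nra.
rewrite /mu1 /mu0 /mum1.
have [c0 c1] : (0 <= mu1 alpha * (2 - alpha) * (3 - alpha)
    + mu0 alpha * (2 - alpha) * 4 + mum1 alpha * 12) /\
   (0 <= mu1 alpha * (5 - 2 * alpha)
    + mu0 alpha * (6 - alpha) + mum1 alpha * 7).
  rewrite /mu1 /mu0 /mum1; split; nra.
rewrite /mu1 /mu0 /mum1 in c0 c1; nra.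
Qed.

(** Both combinations vanish at alpha = 1. After a factor b = alpha - 1 is taken out, the cofactor
    is positive on ]0, 1[ by comparing powers of b. *)
Lemma weight_01_gt0 (R : realType) (alpha : R) : 1 < alpha < 2 ->
  0 < weight alpha 0 0 0 + weight alpha 0 0 2 /\
  0 < weight alpha 0 0 0 + weight alpha 0 0 2 + 4 * weight alpha 0 0 3.
Proof.
move=> a12; have /andP[a1 a2] := a12.
rewrite /weight !mulr0 expR0 !mulr1 !gwS// gw0// /mu1 /mu0 /mum1 /=.
pose b := alpha - 1.
have b0 : 0 < b by rewrite /b; lra.
have b1 : b < 1 by rewrite /b; lra.
have -> : alpha = b + 1 by rewrite subrK.
have [b2_ge0 b2_le1] : 0 <= b ^+ 2 /\ b ^+ 2 <= b by split; nra.
have [b3_ge0 b3_le1] : 0 <= b ^+ 3 /\ b ^+ 3 <= b ^+ 2 by rewrite !exprS; split; nra.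
have [b4_ge0 b4_le1] : 0 <= b ^+ 4 /\ b ^+ 4 <= b ^+ 3 by rewrite !exprS; split; nra.
split.
  rewrite [ltRHS](_ : _ = b * ((28 + 67 * b + 26 * b ^+ 2 + 3 * b ^+ 3) / 48)).
    by rewrite mulr_gt0//; lra.
  by field.
rewrite [ltRHS](_ : _ = b * ((300 + 221 * b - 222 * b ^+ 2 - 107 * b ^+ 3
    - 12 * b ^+ 4) / 144)).
  by apply: (mulr_gt0 b0); apply: divr_gt0; lra.
by field.
Qed.

(** Partial sums of the coefficients of (1 - x)^alpha are the coefficients of (1 - x)^(alpha - 1);
    the recurrence makes the induction telescope. *)
Lemma sum_gw (R : realType) (alpha : R) (n : nat) : 1 < alpha < 2 ->
  \sum_(0 <= k < n.+1) gw alpha k = - (n.+1%:R * gw alpha n.+1) / alpha.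
Proof.
move=> a12; have /andP[a1 a2] := a12; elim: n => [|n ih].
  by rewrite big_nat1 gwS// gw0//=; field; lra.
rewrite big_nat_recr//= ih [in RHS]gw_mulnS//.
by field; lra.
Qed.

(* The weights are the coefficients of (mu1 + mu0 x + mum1 x^2) (1 - x)^alpha. *)
Lemma sum_weight (R : realType) (alpha x : R) (n : nat) :
  \sum_(0 <= k < n.+3) weight alpha 0 0 k * x ^+ k
  = mu1 alpha * (\sum_(0 <= k < n.+3) gw alpha k * x ^+ k)
  + mu0 alpha * x * (\sum_(0 <= k < n.+2) gw alpha k * x ^+ k)
  + mum1 alpha * x ^+ 2 * (\sum_(0 <= k < n.+1) gw alpha k * x ^+ k).
Proof.
elim: n => [|n ih].
  rewrite /= !big_nat_recl//= !big_geq// /weight !mulr0 expR0 /=.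
  by rewrite !mulr1 !exprS expr0; ring.
rewrite big_nat_recr//= ih !(big_nat_recr _ 0%N)//= !mulr0 expR0 mulr1.
by rewrite !exprS expr0; ring.
Qed.

(** The symbol at x = 1. The closed form of the partial sums reduces everything to -g_(n+2) / (alpha
    (n+3)) times a quadratic in n with leading coefficient 1 and nonnegative coefficients. *)
Lemma sum_weight_le0 (R : realType) (alpha : R) (n : nat) : 1 < alpha < 2 ->
  \sum_(0 <= k < n.+4) weight alpha 0 0 k <= 0.
Proof.
move=> a12; have /andP[a1 a2] := a12.
have := sum_weight R alpha 1 n.+1.
under eq_bigr do rewrite expr1n mulr1.
move=> ->.
do 3 (under eq_bigr do rewrite expr1n mulr1; rewrite sum_gw//).
have g2 := gw_ge0 R alpha n a12.
rewrite (gw_mulnS _ _ n.+3)// (gwS _ _ n.+2)//.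
pose x : R := n%:R.
have x0 : 0 <= x by [].
have n2 : n.+2%:R = x + 2 :> R by rewrite -addn2 natrD.
have n3 : n.+3%:R = x + 3 :> R by rewrite -addn3 natrD.
rewrite expr1n !mulr1 n2 n3; set g := gw alpha n.+2 in g2 *.
suff P : 0 <= mu1 alpha * (x + 2 - alpha) * (x + 3 - alpha)
    + mu0 alpha * (x + 2 - alpha) * (x + 3)
    + mum1 alpha * (x + 2) * (x + 3).
  rewrite (_ : _ + _ = - (g / (alpha * (x + 3)) *
    (mu1 alpha * (x + 2 - alpha) * (x + 3 - alpha)
    + mu0 alpha * (x + 2 - alpha) * (x + 3)
    + mum1 alpha * (x + 2) * (x + 3)))); last first.
    by field; rewrite ?andbT; apply/andP; split; lra.
  rewrite oppr_le0; apply: mulr_ge0 => //; apply: divr_ge0 => //; nra.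
have [c0 c1] : (0 <= mu1 alpha * (2 - alpha) * (3 - alpha)
    + mu0 alpha * (2 - alpha) * 3 + mum1 alpha * 6) /\
   (0 <= mu1 alpha * (5 - 2 * alpha)
    + mu0 alpha * (5 - alpha) + mum1 alpha * 5).
  pose b := alpha - 1.
  have b0 : 0 < b by rewrite /b; lra.
  have b1 : b < 1 by rewrite /b; lra.
  have -> : alpha = b + 1 by rewrite subrK.
  (* The constant coefficient is a quartic in b whose minimum on [0, 1] lies near 9/10; squares
     centred there certify its sign. *)
  have sq1 : 0 <= (b - 9 / 10) ^+ 2 by exact: sqr_ge0.
  have sq2 : 0 <= b * (b - 9 / 10) ^+ 2 by rewrite mulr_ge0// ltW.
  have sq3 : 0 <= b ^+ 4 by rewrite exprn_ge0// ltW.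
  have sq4 : b ^+ 2 <= b by nra.
  rewrite /mu1 /mu0 /mum1; split.
    rewrite [leRHS](_ : _ = (3 * b ^+ 4 + 20 * (b * (b - 9 / 10) ^+ 2)
      + 51 * (b - 9 / 10) ^+ 2 + (18 + 69 / 100 - 104 / 10 * b)) / 24); last by field.
    lra.
  rewrite [leRHS](_ : _ = (84 - 48 * b - 12 * b ^+ 2) / 24); last by field.
  lra.
have mu1s : mu1 alpha + mu0 alpha + mum1 alpha = 1.
  by rewrite /mu1 /mu0 /mum1; field.
rewrite [leRHS](_ : _ = (mu1 alpha + mu0 alpha + mum1 alpha) * x ^+ 2
    + x * (mu1 alpha * (5 - 2 * alpha) + mu0 alpha * (5 - alpha) + mum1 alpha * 5)
    + (mu1 alpha * (2 - alpha) * (3 - alpha)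
    + mu0 alpha * (2 - alpha) * 3 + mum1 alpha * 6)); last by ring.
rewrite mu1s mul1r; apply: addr_ge0 => //; apply: addr_ge0.
  exact: sqr_ge0.
exact: mulr_ge0.
Qed.

(** * The binomial series of (1 - x)^alpha *)

Lemma is_derive_binomial (R : realType) (alpha x : R) (n : nat) :
  is_derive x (1 : R) (fun y : R => \sum_(0 <= k < n) gw alpha k * y ^+ k)
    (\sum_(0 <= k < n) gw alpha k * (k%:R * x ^+ k.-1)).
Proof.
elim: n => [|n ih].
  rewrite big_geq// (_ : (fun _ => _) = cst 0); first exact: is_derive_cst.
  by apply/funext => y; rewrite big_geq.
rewrite big_nat_recr//= (_ : (fun _ => _) = (fun y =>
  (\sum_(0 <= k < n) gw alpha k * y ^+ k) + gw alpha n * y ^+ n)); last first.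
  by apply/funext => y; rewrite big_nat_recr.
apply: is_deriveD.
have dX : is_derive x (1 : R) (fun y : R => y ^+ n) (n%:R * x ^+ n.-1).
  have := is_deriveX n (is_derive_id x (1 : R)).
  rewrite (_ : (id ^+ n)%R = fun y : R => y ^+ n); last first.
    by apply/funext => y; rewrite fctE.
  by move=> dX; apply: is_derive_eq; exact: mulr1.
exact: (@is_deriveZ _ _ _ _ (gw alpha n) _ _ _ dX).
Qed.

(** The full series solves (1 - x) p' + alpha p = 0; truncation leaves one term, since all the
    others cancel by the recurrence. *)
Lemma binomial_ode (R : realType) (alpha x : R) (n : nat) : 1 < alpha < 2 ->
  (1 - x) * (\sum_(0 <= k < n.+1) gw alpha k * (k%:R * x ^+ k.-1))
  + alpha * (\sum_(0 <= k < n.+1) gw alpha k * x ^+ k)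
  = - (n%:R - alpha) * gw alpha n * x ^+ n.
Proof.
move=> a12; elim: n => [|n ih].
  by rewrite !big_nat1 gw0//=; ring.
rewrite big_nat_recr//= [X in _ + alpha * X]big_nat_recr//=.
rewrite !mulrDr addrACA ih.
have E := gw_mulnS R alpha n a12.
by rewrite [- _ * _]mulNr -E mulNr -natr1 exprS; ring.
Qed.

(** The quotient q = p / (1 - x)^alpha of the partial sum p satisfies q(0) = 1, and by
    [binomial_ode] its derivative is a single term; the mean value theorem then gives the
    remainder. *)
Lemma binomial_partial_sum (R : realType) (alpha x : R) (n : nat) :
  1 < alpha < 2 -> 0 < x < 1 ->
  `|(1 - x) `^ alpha - \sum_(0 <= k < n.+3) gw alpha k * x ^+ k|
    <= 2 / (1 - x) * x ^+ n.+2.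
Proof.
move=> a12 /andP[x0 x1]; have /andP[a1 a2] := a12.
pose p (y : R) : R := \sum_(0 <= k < n.+3) gw alpha k * y ^+ k.
pose q (y : R) : R := (1 - y) `^ (- alpha) * p y.
pose dq (y : R) : R := - (n.+2%:R - alpha) * gw alpha n.+2 * y ^+ n.+2
  * (1 - y) `^ (- alpha - 1).
have d_q (y : R) : y < 1 -> is_derive y (1 : R) q (dq y).
  move=> y1; have y10 : 0 < 1 - y by rewrite subr_gt0.
  have d1 : is_derive y (1 : R) (fun y => 1 - y) (-1).
    have := is_deriveB (is_derive_cst (1 : R) y 1) (is_derive_id y (1 : R)).
    by rewrite sub0r.
  have d2 := @is_derive1_comp R (fun z => z `^ (- alpha)) (fun y => 1 - y) y _ _
    (is_derive1_powR (- alpha) y10) d1.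
  have d3 := is_derive_binomial R alpha y n.+3.
  have d4 : is_derive y (1 : R) q _ := is_deriveM d2 d3.
  apply: is_derive_eq => /=.
  rewrite /dq -(binomial_ode _ _ y n.+2 a12) /GRing.scale/=.
  have -> : (1 - y) `^ (- alpha) = (1 - y) * (1 - y) `^ (- alpha - 1).
    rewrite -[X in X * _](powRr1 (ltW y10)) -powRD; first by congr (_ `^ _); ring.
    by apply/implyP => _; rewrite gt_eqF.
  by ring.
have [||c] := @MVT_segment R q dq 0 x (ltW x0).
- by move=> y; rewrite in_itv/= => /andP[_ yx]; apply: d_q; exact: lt_trans x1.
- apply/subspace_continuousP => y; rewrite /= in_itv/= => /andP[_ yx].
  apply: cvg_within_filter; apply: (is_derive_continuous _ _ _ _ (d_q y _)).
  exact: le_lt_trans x1.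
rewrite in_itv/= => /andP[c0 cx].
have -> : q 0 = 1.
  rewrite /q /p subr0 powR1 mul1r big_nat_recl//= gw0// expr0 mulr1 big1 ?addr0//.
  by move=> k _; rewrite exprS mul0r mulr0.
rewrite subr0 => qx.
have x10 : 0 < 1 - x by rewrite subr_gt0.
have c10 : 0 < 1 - c by rewrite subr_gt0 (le_lt_trans cx).
have -> : (1 - x) `^ alpha - p x = (1 - x) `^ alpha * (1 - q x).
  rewrite /q mulrBr mulr1 mulrA powRN divff ?mul1r//.
  by rewrite gt_eqF// powR_gt0.
have -> : 1 - q x = - (dq c * x) by rewrite -qx opprB.
have g2 := gw_ge0 R alpha n a12; have gl := gw_muln_le R alpha n a12.
have na : 0 <= n.+2%:R - alpha by rewrite subr_ge0 (le_trans (ltW a2))// ler_nat.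
rewrite /dq -!mulNr !opprK normrM ger0_norm ?powR_ge0// ger0_norm; last first.
  apply: mulr_ge0 (ltW x0); apply: mulr_ge0 (powR_ge0 _ _).
  by apply: mulr_ge0 (exprn_ge0 _ c0); exact: mulr_ge0.
have le1 : (n.+2%:R - alpha) * gw alpha n.+2 <= 2.
  by apply: le_trans gl; rewrite ler_wpM2r// gerBl; lra.
(* Since c <= x, the factor (1 - x)^alpha compensates (1 - c)^(-alpha) and only one power of 1 / (1
   - c) remains. *)
have le2 : (1 - x) `^ alpha * (1 - c) `^ (- alpha - 1) <= (1 - x)^-1.
  have := @powRB R (1 - c) (- alpha) 1.
  rewrite powRr1 ?(ltW c10)// => ->; last by apply/implyP => _; rewrite gt_eqF.
  rewrite powRN.
  have : (1 - x) `^ alpha <= (1 - c) `^ alpha.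
    by apply: ge0_ler_powR; rewrite ?nnegrE; lra.
  move=> le3; rewrite mulrA.
  apply: (@le_trans _ _ (1 - c)^-1).
    rewrite ler_piMl ?invr_ge0 ?(ltW c10)//.
    by rewrite ler_pdivrMr ?mul1r// powR_gt0.
  by rewrite lef_pV2 ?posrE// lerD2l lerN2.
have le3 : c ^+ n.+2 <= x ^+ n.+2 by rewrite lerXn2r ?nnegrE ?(ltW x0).
set A := (n.+2%:R - alpha) * gw alpha n.+2 in le1 *.
have A0 : 0 <= A by rewrite mulr_ge0.
rewrite (_ : (1 - x) `^ alpha * _ =
  A * ((1 - x) `^ alpha * (1 - c) `^ (- alpha - 1)) * c ^+ n.+2 * x); last by ring.
set B := (1 - x) `^ alpha * (1 - c) `^ (- alpha - 1) in le2 *.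
have B0 : 0 <= B by exact: mulr_ge0 (powR_ge0 _ _) (powR_ge0 _ _).
have cn0 : 0 <= c ^+ n.+2 by exact: exprn_ge0.
have AB0 : 0 <= A * B by exact: mulr_ge0.
apply: (@le_trans _ _ (A * B * c ^+ n.+2)).
  by rewrite ler_piMr ?(ltW x1)//; exact: mulr_ge0.
by apply: ler_pM => //; apply: ler_pM.
Qed.

Lemma cvg_geometric_tail (R : realType) (x c : R) (m : nat) : 0 < x < 1 ->
  ((c * x ^+ (n + m)) @[n --> \oo] --> (0 : R))%classic.
Proof.
move=> /andP[x0 x1]; rewrite -[X in (_ --> X)%classic](mulr0 c); apply: cvgMr.
rewrite (cvg_shiftn m (GRing.exp x)); apply: cvg_expr.
by rewrite ger0_norm ?ltW.
Qed.

(** The offset m lets the three sums of different length in [sum_weight] converge along one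
    index. *)
Lemma binomial_cvg (R : realType) (alpha x : R) (m : nat) :
  1 < alpha < 2 -> 0 < x < 1 ->
  ((\sum_(0 <= k < n + m.+3) gw alpha k * x ^+ k) @[n --> \oo]
    --> (1 - x) `^ alpha)%classic.
Proof.
move=> a12 x01.
have c1 := cvg_geometric_tail R x (2 / (1 - x)) m.+2 x01.
apply: (@squeeze_cvgr _ _ _ _
  (fun n => (1 - x) `^ alpha - 2 / (1 - x) * x ^+ (n + m.+2))
  (fun n => (1 - x) `^ alpha + 2 / (1 - x) * x ^+ (n + m.+2))).
- near=> n; have := binomial_partial_sum R alpha x (n + m) a12 x01.
  by rewrite !addnS ler_distlC => /andP[-> ->].
- by rewrite -[X in (_ --> X)%classic]subr0; apply: cvgB => //; exact: cvg_cst.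
- by rewrite -[X in (_ --> X)%classic]addr0; apply: cvgD => //; exact: cvg_cst.
Unshelve. all: by end_near. Qed.

(** From index 4 on the terms are nonnegative, so the partial sums increase to their limit, the
    value of the generating function. *)
Lemma sum_weight_le (R : realType) (alpha x : R) (n : nat) :
  1 < alpha < 2 -> 0 < x < 1 ->
  \sum_(0 <= k < n.+4) weight alpha 0 0 k * x ^+ k
  <= (mu1 alpha + mu0 alpha * x + mum1 alpha * x ^+ 2) * (1 - x) `^ alpha.
Proof.
move=> a12 x01; have /andP[x0 x1] := x01.
pose u m := \sum_(0 <= k < m + 5) weight alpha 0 0 k * x ^+ k.
have cu : (u m @[m --> \oo] -->
    (mu1 alpha + mu0 alpha * x + mum1 alpha * x ^+ 2) * (1 - x) `^ alpha)%classic.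
  rewrite /u; under eq_cvg do rewrite addnS addnS addnS sum_weight -!addnS.
  rewrite !mulrDl; apply: cvgD; first apply: cvgD.
  - by apply: cvgMr; exact: (binomial_cvg _ _ _ 2).
  - by apply: cvgMr; exact: (binomial_cvg _ _ _ 1).
  - by apply: cvgMr; exact: (binomial_cvg _ _ _ 0).
have nu : nondecreasing_seq u.
  apply/nondecreasing_seqP => m; rewrite /u !addnS [leRHS]big_nat_recr//= lerDl.
  by rewrite mulr_ge0 ?exprn_ge0 ?(ltW x0)// weight_ge0.
apply: (@le_trans _ _ (u n)).
  rewrite /u !addnS addn0 [leRHS]big_nat_recr//= lerDl.
  by rewrite mulr_ge0 ?exprn_ge0 ?(ltW x0)// weight_ge0.
rewrite -(cvg_lim _ cu)//; apply: nondecreasing_cvgn_le => //.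
by apply/cvg_ex; eexists; exact: cu.
Qed.

(** * Toeplitz quadratic forms *)

(** Under [interior_supp] the indices past M contribute nothing, so this is the autocorrelation of v
    extended by zero. *)
Definition autocorr {R : realType} (M : nat) (v : nat -> R) (k : nat) : R :=
  \sum_(0 <= i < M) v i * v (i + k)%N.

Definition interior_supp {R : realType} (M : nat) (v : nat -> R) : Prop :=
  v 0%N = 0 /\ forall i, (M <= i)%N -> v i = 0.

Lemma sum_interior (R : realType) (M : nat) (F : nat -> R) : F 0%N = 0 ->
  \sum_(1 <= i < M) F i = \sum_(0 <= i < M) F i.
Proof.
move=> F0; case: M => [|M]; first by rewrite !big_geq.
by rewrite [RHS]big_ltn// F0 add0r.
Qed.

Lemma sum_succ (R : realType) (M : nat) (F : nat -> R) :
  F 0%N = 0 -> F M = 0 ->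
  \sum_(0 <= i < M) F i.+1 = \sum_(0 <= i < M) F i.
Proof.
move=> F0 FM.
have : \sum_(0 <= i < M.+1) F i = \sum_(0 <= i < M) F i + F M.
  by rewrite big_nat_recr.
by rewrite big_nat_recl// F0 FM add0r addr0.
Qed.

Lemma sum_shift_le (R : realType) (M k : nat) (F : nat -> R) :
  (forall i, 0 <= F i) -> (forall i, (M <= i)%N -> F i = 0) ->
  \sum_(0 <= i < M) F (i + k)%N <= \sum_(0 <= i < M) F i.
Proof.
move=> F0 FM; elim: k => [|k ih].
  by under eq_bigr do rewrite addn0.
apply: le_trans ih.
have : \sum_(0 <= i < M.+1) F (i + k)%N = \sum_(0 <= i < M) F (i + k)%N + F (M + k)%N.
  by rewrite big_nat_recr.
rewrite big_nat_recl// (FM (M + k)%N) ?leq_addr// addr0 => <-.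
rewrite (eq_bigr (fun i => F (i.+1 + k)%N)) ?lerDr// => i _.
by rewrite addSnnS.
Qed.

Lemma autocorr0 (R : realType) (M : nat) (v : nat -> R) :
  autocorr M v 0 = \sum_(0 <= i < M) v i ^+ 2.
Proof. by apply: eq_bigr => i _; rewrite addn0 expr2. Qed.

Lemma autocorr0_ge0 (R : realType) (M : nat) (v : nat -> R) :
  0 <= autocorr M v 0.
Proof. by rewrite autocorr0 sumr_ge0// => i _; rewrite sqr_ge0. Qed.

Lemma sum_sqr_shift (R : realType) (M k : nat) (v : nat -> R) :
  interior_supp M v ->
  \sum_(0 <= i < M) v (i + k)%N ^+ 2 <= autocorr M v 0.
Proof.
move=> [_ vM]; rewrite autocorr0.
apply: (@sum_shift_le _ M k (fun i => v i ^+ 2)) => i; first exact: sqr_ge0.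
by move=> /vM ->; rewrite expr0n.
Qed.

(** Expand the sum of (v_i - v_(i+k))^2; shifted squares sum to at most the unshifted ones. The
    lower bound that follows uses the plus sign. *)
Lemma autocorr_le (R : realType) (M k : nat) (v : nat -> R) :
  interior_supp M v -> autocorr M v k <= autocorr M v 0.
Proof.
move=> sv; have := sum_sqr_shift _ _ k _ sv.
have : 0 <= \sum_(0 <= i < M) (v i - v (i + k)%N) ^+ 2.
  by apply: sumr_ge0 => i _; exact: sqr_ge0.
suff -> : \sum_(0 <= i < M) (v i - v (i + k)%N) ^+ 2 = autocorr M v 0
    - 2 * autocorr M v k + \sum_(0 <= i < M) v (i + k)%N ^+ 2 by lra.
rewrite autocorr0 /autocorr mulr_sumr -sumrB -big_split.
by apply: eq_bigr => i _ /=; ring.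
Qed.

Lemma autocorr_geN (R : realType) (M k : nat) (v : nat -> R) :
  interior_supp M v -> - autocorr M v 0 <= autocorr M v k.
Proof.
move=> sv; have := sum_sqr_shift _ _ k _ sv.
have : 0 <= \sum_(0 <= i < M) (v i + v (i + k)%N) ^+ 2.
  by apply: sumr_ge0 => i _; exact: sqr_ge0.
suff -> : \sum_(0 <= i < M) (v i + v (i + k)%N) ^+ 2 = autocorr M v 0
    + 2 * autocorr M v k + \sum_(0 <= i < M) v (i + k)%N ^+ 2 by lra.
rewrite autocorr0 /autocorr mulr_sumr -!big_split.
by apply: eq_bigr => i _ /=; ring.
Qed.

Lemma sum_mul_pred (R : realType) (M : nat) (v : nat -> R) :
  interior_supp M v ->
  \sum_(0 <= i < M) v i * v i.-1 = autocorr M v 1.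
Proof.
move=> [v0 vM]; rewrite -(@sum_succ _ M (fun i => v i * v i.-1)) ?v0 ?(vM M) ?mul0r//.
by apply: eq_bigr => i _; rewrite addn1 mulrC.
Qed.

(* The square of the second difference of v, extended by zero to all integers,
   has a nonnegative sum. *)
Lemma autocorr_second_difference (R : realType) (M : nat) (v : nat -> R) :
  interior_supp M v ->
  autocorr M v 0 - autocorr M v 2 <= 4 * (autocorr M v 0 - autocorr M v 1).
Proof.
move=> sv; have [v0 vM] := sv.
have e1 := sum_sqr_shift _ _ 1 _ sv; have e2 := sum_sqr_shift _ _ 2 _ sv.
have : 0 <= \sum_(0 <= i < M) (v i - 2 * v (i + 1)%N + v (i + 2)%N) ^+ 2.
  by apply: sumr_ge0 => i _; exact: sqr_ge0.
have c12 : \sum_(0 <= i < M) v (i + 1)%N * v (i + 2)%N = autocorr M v 1.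
  rewrite /autocorr -(@sum_succ _ M (fun i => v i * v (i + 1)%N)).
  - by apply: eq_bigr => i _; rewrite addn1 addn2 addn1.
  - by rewrite v0 mul0r.
  - by rewrite vM// mul0r.
suff -> : \sum_(0 <= i < M) (v i - 2 * v (i + 1)%N + v (i + 2)%N) ^+ 2 =
    autocorr M v 0 + 4 * (\sum_(0 <= i < M) v (i + 1)%N ^+ 2)
    + \sum_(0 <= i < M) v (i + 2)%N ^+ 2 + 2 * autocorr M v 2
    - 4 * autocorr M v 1 - 4 * autocorr M v 1 by lra.
rewrite -[in X in _ - X]c12 autocorr0 /autocorr !mulr_sumr -!big_split/= -!sumrB.
by apply: eq_bigr => i _ /=; ring.
Qed.

(** The gap is the sum of t_k (c_0 - c_k), where every difference is nonnegative. Only t_2 may be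
    negative, and then c_0 - c_2 <= 4 (c_0 - c_1) charges it to t_1. *)
Lemma toeplitz_form_le (R : realType) (M n : nat) (t v : nat -> R) (S : R) :
  interior_supp M v -> 0 <= t 1%N -> 0 <= t 1%N + 4 * t 2%N ->
  (forall k, 0 <= t k.+3) -> \sum_(0 <= k < n.+3) t k <= S ->
  \sum_(0 <= k < n.+3) t k * autocorr M v k <= S * autocorr M v 0.
Proof.
move=> sv t1 t12 t3 tS.
apply: (@le_trans _ _ ((\sum_(0 <= k < n.+3) t k) * autocorr M v 0)); last first.
  by rewrite ler_wpM2r// autocorr0_ge0.
rewrite mulr_suml -subr_ge0 -sumrB.
rewrite (eq_bigr (fun k => t k * (autocorr M v 0 - autocorr M v k))); last first.
  by move=> k _; rewrite mulrBr.
rewrite !big_nat_recl//= subrr mulr0 add0r addrA; apply: addr_ge0.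
  have d1 : 0 <= autocorr M v 0 - autocorr M v 1 by rewrite subr_ge0 autocorr_le.
  have d2 : 0 <= autocorr M v 0 - autocorr M v 2 by rewrite subr_ge0 autocorr_le.
  have d12 := autocorr_second_difference _ _ _ sv.
  have [t2|t2] := leP 0 (t 2%N); nra.
by apply: sumr_ge0 => k _; rewrite mulr_ge0// subr_ge0 autocorr_le.
Qed.

(** The weight w_0 pairs v_i with v_(i+1), and w_(k+1) pairs v_i with v_(i-k); hence w_0 and w_2
    both multiply [autocorr M v 1]. Lags beyond the grid give 0, so any n >= M may be taken. *)
Lemma hessenberg_form (R : realType) (M n : nat) (w v : nat -> R) :
  interior_supp M v -> (M <= n)%N ->
  \sum_(1 <= i < M) v i * (\sum_(0 <= k < i.+2) w k * v (i.+1 - k)%N)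
  = w 0%N * autocorr M v 1 + \sum_(0 <= k < n) w k.+1 * autocorr M v k.
Proof.
move=> sv Mn; have [v0 vM] := sv.
rewrite sum_interior ?v0 ?mul0r//.
have inner i : (0 <= i < M)%N ->
    v i * (\sum_(0 <= k < i.+2) w k * v (i.+1 - k)%N)
    = w 0%N * (v i * v (i + 1)%N)
    + \sum_(0 <= k < n) w k.+1 * (v i * (if (k <= i)%N then v (i - k)%N else 0)).
  move=> /andP[_ iM]; rewrite big_nat_recl// subn0 addn1 mulrDr mulrCA; congr (_ + _).
  have in_ : (i.+1 <= n)%N by exact: leq_trans Mn.
  rewrite [RHS](big_cat_nat (n := i.+1))//= [X in _ = _ + X]big_nat_cond.
  rewrite [X in _ = _ + X]big1 ?addr0; last first.
    by move=> k /andP[/andP[ik _] _]; rewrite leqNgt ik /= !mulr0.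
  rewrite mulr_sumr !big_nat; apply: eq_bigr => k /andP[_ ki].
  by rewrite -ltnS ki subSS mulrCA.
rewrite big_nat (eq_bigr _ inner) -big_nat big_split/= -mulr_sumr.
congr (_ + _); rewrite exchange_big/=; apply: eq_bigr => k _.
rewrite -mulr_sumr; congr (_ * _).
have [kM|Mk] := leqP k M; last first.
  rewrite /autocorr big_nat big1 1?big_nat ?big1// => i /andP[_ iM].
    by rewrite (vM (i + k)%N) ?mulr0// (leq_trans (ltnW Mk))// leq_addl.
  by rewrite leqNgt (leq_trans iM (ltnW Mk)) mulr0.
rewrite (big_cat_nat (n := k))//= big_nat big1 ?add0r; last first.
  by move=> i /andP[_ ik]; rewrite leqNgt ik mulr0.
rewrite /autocorr [RHS](big_cat_nat (n := (M - k)%N))//= ?leq_subr//.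
rewrite [X in _ = _ + X]big_nat [X in _ = _ + X]big1 ?addr0; last first.
  by move=> i /andP[ik _]; rewrite (vM (i + k)%N) ?mulr0// addnC -leq_subLR.
rewrite -[X in \sum_(X <= _ < _) _]add0n big_addn; apply: eq_bigr => i _.
by rewrite leq_addl addnK mulrC.
Qed.

(** * The form of the tempered operator *)

(** Used at x = e^(-lambda h). The endpoint x = 1 is the untempered case, where the right-hand side
    vanishes and [sum_weight_le0] takes over. *)
Lemma sum_weight_le_in01 (R : realType) (alpha x : R) (n : nat) :
  1 < alpha < 2 -> 0 < x <= 1 ->
  \sum_(0 <= k < n.+4) weight alpha 0 0 k * x ^+ k
  <= (mu1 alpha + mu0 alpha * x + mum1 alpha * x ^+ 2) * (1 - x) `^ alpha.
Proof.
move=> a12 /andP[x0]; rewrite le_eqVlt => /predU1P[->|x1].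
  rewrite subrr powR0 ?mulr0; last by rewrite gt_eqF//; lra.
  by under eq_bigr do rewrite expr1n mulr1; exact: sum_weight_le0.
by apply: sum_weight_le => //; rewrite x0.
Qed.

Lemma expR_small (R : realType) (s : R) : 0 <= s <= 1 / 2 ->
  [/\ 1 + s <= expR s <= 1 + 2 * s, 1 - s <= expR (- s) <= 1 &
      expR (- s) * (1 + s) <= 1].
Proof.
move=> /andP[s0 s1]; have p1 := expR_ge1Dx s; have q1 := expR_ge1Dx (- s).
have pq : expR s * expR (- s) = 1 by rewrite -expRD subrr expR0.
have p0 := expR_gt0 s; have q0 := expR_gt0 (- s).
set p := expR s in p1 pq p0 *; set q := expR (- s) in q1 pq q0 *.
have ql : q <= 1 by nra.
have qs : q * (1 + s) <= 1 by nra.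
by split=> //; apply/andP; split=> //; nra.
Qed.

(* The symbol of the tempered scheme at frequency zero, times h^alpha, with
   s = lambda h; the factor s^alpha cancels to first order. *)
Lemma tempered_symbol0_le (R : realType) (alpha s : R) (n : nat) :
  1 < alpha < 2 -> 0 <= s <= 1 / 2 ->
  \sum_(0 <= k < n.+4) weight alpha 0 0 k * expR ((1 - k%:R) * s)
  - alpha * s `^ (alpha - 1) / 2 * (expR s - expR (- s))
  + s `^ alpha * (alpha - 1) * (2 / 3 + (expR s + expR (- s)) / 6)
  <= 5 * s `^ alpha * s.
Proof.
move=> a12 s01; have /andP[a1 a2] := a12; have /andP[s0 s1] := s01.
have [/andP[p1 p2] /andP[q1 q2] q3] := expR_small _ _ s01.
have pq : expR s * expR (- s) = 1 by rewrite -expRD subrr expR0.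
(* Up to the factor e^s this is the generating function of the weights at x = e^(-s). *)
have sE : \sum_(0 <= k < n.+4) weight alpha 0 0 k * expR ((1 - k%:R) * s)
    = expR s * \sum_(0 <= k < n.+4) weight alpha 0 0 k * expR (- s) ^+ k.
  rewrite mulr_sumr; apply: eq_bigr => k _.
  rewrite mulrCA; congr (_ * _); rewrite -expRM_natl -expRD; congr expR.
  by ring.
have x01 : 0 < expR (- s) <= 1 by rewrite expR_gt0.
have := sum_weight_le_in01 _ _ _ n a12 x01.
rewrite sE; set Sg := \sum_(0 <= k < n.+4) _.
have p0 := expR_gt0 s; have q0 := expR_gt0 (- s).
have -> : s `^ alpha = s * s `^ (alpha - 1) by rewrite mulr_powRB1//; lra.
have le_s : (1 - expR (- s)) `^ alpha <= s * s `^ (alpha - 1).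
  rewrite mulr_powRB1//; last lra.
  by apply: ge0_ler_powR; rewrite ?nnegrE; lra.
have z0 := powR_ge0 (1 - expR (- s)) alpha.
have t0 := powR_ge0 s (alpha - 1).
set p := expR s in p0 p1 p2 pq *; set q := expR (- s) in q0 q1 q2 q3 pq z0 le_s *.
set z := (1 - q) `^ alpha in z0 le_s *; set t := s `^ (alpha - 1) in t0 le_s *.
move=> SgL.
have b1 : p * Sg <= (mu1 alpha * p + mu0 alpha + mum1 alpha * q) * z.
  apply: (@le_trans _ _ (p * ((mu1 alpha + mu0 alpha * q + mum1 alpha * q ^+ 2) * z))).
    by rewrite ler_pM2l.
  rewrite [leRHS](_ : _ = (mu1 alpha * p + mu0 alpha * (p * q)
     + mum1 alpha * (p * q) * q) * z); last by rewrite pq !mulr1.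
  by rewrite le_eqVlt; apply/orP; left; apply/eqP; ring.
have m1 : 1 / 2 <= mu1 alpha <= 13 / 12 by rewrite /mu1; apply/andP; split; nra.
have m0 : - 1 / 6 <= mu0 alpha <= 1 / 2 by rewrite /mu0; apply/andP; split; nra.
have mm : - 1 / 12 <= mum1 alpha <= 1 / 12 by rewrite /mum1; apply/andP; split; nra.
have mu1s : mu1 alpha + mu0 alpha + mum1 alpha = 1.
  by rewrite /mu1 /mu0 /mum1; field.
move: m1 m0 mm => /andP[m11 m12] /andP[m01 m02] /andP[mm1 mm2].
have bracket0 : 0 <= mu1 alpha * p + mu0 alpha + mum1 alpha * q by nra.
have bracket1 : mu1 alpha * p + mu0 alpha + mum1 alpha * q <= 1 + 3 * s.
  have : mu1 alpha * p <= mu1 alpha * (1 + 2 * s) by rewrite ler_wpM2l//; lra.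
  have : mum1 alpha * q <= mum1 alpha + 1 / 12 * s by nra.
  have : mu1 alpha * s <= 13 / 12 * s by rewrite ler_wpM2r.
  lra.
have b2 : (mu1 alpha * p + mu0 alpha + mum1 alpha * q) * z <= (1 + 3 * s) * (s * t).
  by apply: ler_pM.
have sinh : s * (2 - s) <= p - q by nra.
have b3 : alpha * t / 2 * (s * (2 - s)) <= alpha * t / 2 * (p - q).
  by rewrite ler_wpM2l// mulr_ge0// mulr_ge0//; lra.
have b4 : s * t * (alpha - 1) * (2 / 3 + (p + q) / 6) <=
    s * t * (alpha - 1) * (1 + s / 3).
  by rewrite ler_wpM2l//; [apply: mulr_ge0; [exact: mulr_ge0|lra]|lra].
have st0 : 0 <= s * t * s by rewrite !mulr_ge0.
have b5 : alpha * (s * t * s) <= 2 * (s * t * s) by rewrite ler_wpM2r// ltW.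
(* With s^alpha = s t the first-order terms s t, - alpha s t and (alpha - 1) s t cancel, leaving
   multiples of s^2 t. *)
have sum_eq : (1 + 3 * s) * (s * t) - alpha * t / 2 * (s * (2 - s))
   + s * t * (alpha - 1) * (1 + s / 3)
   = (3 - 1 / 3) * (s * t * s) + (1 / 2 + 1 / 3) * (alpha * (s * t * s)) by field.
rewrite [5 * _ * _](_ : _ = 5 * (s * t * s)); last by ring.
lra.
Qed.

Lemma sum_mul_compact_op (R : realType) (lambda h : R) (M : nat)
    (v : nat -> R) : interior_supp M v ->
  \sum_(1 <= i < M) v i * compact_op lambda h v i
  = 2 / 3 * autocorr M v 0
    + (expR (lambda * h) + expR (- (lambda * h))) / 6 * autocorr M v 1.
Proof.
move=> sv; have [v0 _] := sv.
rewrite sum_interior ?v0 ?mul0r//.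
rewrite [X in _ = _ + X](_ : _ = expR (lambda * h) / 6 * autocorr M v 1
    + expR (- (lambda * h)) / 6 * (\sum_(0 <= i < M) v i * v i.-1)); last first.
  by rewrite sum_mul_pred//; ring.
rewrite autocorr0 /autocorr !mulr_sumr -!big_split/=; apply: eq_bigr => i _.
by rewrite /compact_op addn1; field.
Qed.

Lemma sum_mul_discr_deriv (R : realType) (alpha lambda h : R) (M n : nat)
    (v : nat -> R) : interior_supp M v -> (M <= n)%N ->
  \sum_(1 <= i < M) v i * discr_deriv alpha lambda h v i
  = 1 / h `^ alpha * (weight alpha lambda h 0 * autocorr M v 1
      + \sum_(0 <= k < n) weight alpha lambda h k.+1 * autocorr M v k)
    - alpha * lambda `^ (alpha - 1) / (2 * h)
      * (expR (lambda * h) - expR (- (lambda * h))) * autocorr M v 1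
    + lambda `^ alpha * (alpha - 1)
      * (\sum_(1 <= i < M) v i * compact_op lambda h v i).
Proof.
move=> sv Mn; have [v0 _] := sv.
rewrite -(hessenberg_form _ _ _ _ _ sv Mn).
have -> : alpha * lambda `^ (alpha - 1) / (2 * h)
      * (expR (lambda * h) - expR (- (lambda * h))) * autocorr M v 1 =
  \sum_(1 <= i < M) alpha * lambda `^ (alpha - 1) / (2 * h)
      * (expR (lambda * h) * (v i * v i.+1) - expR (- (lambda * h)) * (v i * v i.-1)).
  rewrite -mulr_sumr sumrB -!mulr_sumr -mulrA mulrBl.
  congr (_ * (_ * _ - _ * _)).
    rewrite sum_interior ?v0 ?mul0r//.
    by apply: eq_bigr => i _; rewrite addn1.
  by rewrite sum_interior ?v0 ?mul0r// sum_mul_pred.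
rewrite !mulr_sumr -sumrB -big_split/=; apply: eq_bigr => i _.
rewrite /discr_deriv; set S := \sum_(0 <= k < i.+2) _; set B := compact_op _ _ _ _.
by ring.
Qed.

(* The quadratic form is a Toeplitz form in the autocorrelation of v: all its
   off-diagonal coefficients are nonnegative, save possibly the one of
   autocorr 2, which the one of autocorr 1 absorbs when lambda h is small. *)
Lemma discr_deriv_form_le (R : realType) (alpha lambda h : R) (M : nat)
    (v : nat -> R) :
  let cw := @weight R alpha 0 0 in
  1 < alpha < 2 -> 0 <= lambda -> 0 < h -> lambda * h <= 1 / 2 ->
  lambda * h * (`|cw 2%N| + 3) <= cw 0%N + cw 2%N ->
  lambda * h * (`|cw 2%N| + 3) <= cw 0%N + cw 2%N + 4 * cw 3%N ->
  interior_supp M v ->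
  \sum_(1 <= i < M) v i * discr_deriv alpha lambda h v i
  <= 5 * lambda `^ alpha * (lambda * h) * autocorr M v 0.
Proof.
move=> cw a12 l0 h0 s12 d1 d2 sv; have /andP[a1 a2] := a12.
rewrite (sum_mul_discr_deriv _ _ _ _ _ M.+3)//; last by rewrite -addn3 leq_addr.
rewrite sum_mul_compact_op//.
have s0 : 0 <= lambda * h by rewrite mulr_ge0// ltW.
have := tempered_symbol0_le R alpha (lambda * h) M a12.
rewrite s0 s12 => /(_ isT).
set s := lambda * h in d1 d2 s0 s12 *.
have s01 : 0 <= s <= 1 / 2 by rewrite s0.
have [/andP[p1 p2] /andP[q1 q2] _] := expR_small _ _ s01.
have lE : lambda `^ alpha = s `^ alpha / h `^ alpha.
  by rewrite powRM ?(ltW h0)// mulfK// gt_eqF// powR_gt0.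
have l1E : lambda `^ (alpha - 1) / h = s `^ (alpha - 1) / h `^ alpha.
  rewrite powRM ?(ltW h0)// -[h `^ alpha](mulr_powRB1 (ltW h0)); last lra.
  have := powR_gt0 (alpha - 1) h0; set y := h `^ (alpha - 1) => y0.
  by field; rewrite !gt_eqF.
have w1 k : weight alpha lambda h k = cw k * expR ((1 - k%:R) * s) by exact: weightE.
have t0 := powR_ge0 s (alpha - 1); have z0 := powR_ge0 s alpha.
have t1 : s `^ (alpha - 1) <= 1.
  have one : 1 `^ (alpha - 1) = 1 :> R by rewrite powR1.
  by rewrite -[leRHS]one; apply: ge0_ler_powR; rewrite ?nnegrE; lra.
(* The coefficients of [autocorr M v k] in h^alpha times the form. Lag 1 collects w_0, w_2, the
   centred difference and the off-diagonal part of the compact operator. *)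
pose t k := match k with
  | 0 => weight alpha lambda h 1 + s `^ alpha * (alpha - 1) * (2 / 3)
  | 1 => weight alpha lambda h 0 + weight alpha lambda h 2
    - alpha * s `^ (alpha - 1) / 2 * (expR s - expR (- s))
    + s `^ alpha * (alpha - 1) * ((expR s + expR (- s)) / 6)
  | k => weight alpha lambda h k.+1
  end.
rewrite (eq_bigr (weight alpha lambda h)); last by move=> k _; rewrite w1.
move=> symb.
(* Tempering costs [|cw 2|] s through e^(-s) >= 1 - s, and the centred difference costs at most 3
   s. *)
have t1_ge : cw 0%N + cw 2%N - s * (`|cw 2%N| + 3) <= t 1%N.
  rewrite /t !w1 -/s subr0 mul1r (_ : (1 - 2%:R) * s = - s); last by ring.
  have cw0 : 0 <= cw 0%N.
    by rewrite /cw /weight mulr0 expR0 gw0// !mulr1 /mu1; nra.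
  have e0 : cw 0%N <= cw 0%N * expR s by rewrite ler_peMr//; lra.
  have e2 : cw 2%N - `|cw 2%N| * s <= cw 2%N * expR (- s).
    have : `|cw 2%N| * (1 - expR (- s)) <= `|cw 2%N| * s by rewrite ler_wpM2l//; lra.
    have : cw 2%N * (1 - expR (- s)) <= `|cw 2%N| * (1 - expR (- s)).
      by rewrite ler_wpM2r ?ler_norm//; lra.
    lra.
  have e3 : alpha * s `^ (alpha - 1) / 2 * (expR s - expR (- s)) <= 1 * (3 * s).
    by apply: ler_pM; nra.
  have e4 : 0 <= s `^ alpha * (alpha - 1) * ((expR s + expR (- s)) / 6).
    by apply: mulr_ge0; [apply: mulr_ge0 => //|]; lra.
  lra.
have tn : \sum_(0 <= k < M.+3) t k <= 5 * s `^ alpha * s.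
  apply: le_trans symb; rewrite le_eqVlt; apply/orP; left; apply/eqP.
  rewrite [in RHS]big_nat_recl// [in RHS]big_nat_recl// [in RHS]big_nat_recl//.
  rewrite [in LHS]big_nat_recl// [in LHS]big_nat_recl//=.
  under [in LHS]eq_bigr do rewrite /t.
  by ring.
have hp : 0 < h `^ alpha by exact: powR_gt0.
rewrite [leLHS](_ : _ = (h `^ alpha)^-1 * \sum_(0 <= k < M.+3) t k * autocorr M v k).
  rewrite [leRHS](_ : _ = (h `^ alpha)^-1
    * (5 * s `^ alpha * s * autocorr M v 0)); last first.
    by rewrite lE; ring.
  rewrite ler_pM2l ?invr_gt0//; apply: toeplitz_form_le => //.
  - by apply: le_trans t1_ge; rewrite subr_ge0.
  - rewrite {2}/t w1 -/s (_ : (1 - 3%:R) * s = - (2 * s)); last by ring.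
    have e2 : 0 < expR (- (2 * s)) <= 1.
      by rewrite expR_gt0 -expR0 ler_expR oppr_le0 mulr_ge0.
    move: e2 => /andP[e20 e21].
    (* If negative, [cw 3] is only damped by its exponential factor, so the untempered inequality
       suffices. *)
    have [cw3|cw3] := leP 0 (cw 3%N).
      apply: addr_ge0; first by apply: le_trans t1_ge; rewrite subr_ge0.
      by rewrite mulr_ge0// mulr_ge0// ltW.
    by have : cw 3%N <= cw 3%N * expR (- (2 * s)); [nra|lra].
  - by move=> k; rewrite /t w1 mulr_ge0 ?expR_ge0// weight_ge0.
rewrite lE [alpha * _ / _](_ : _ = alpha * (lambda `^ (alpha - 1) / h) / 2); last first.
  by field; rewrite gt_eqF.
rewrite l1E.
rewrite [in LHS]big_nat_recl// [in LHS]big_nat_recl//.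
rewrite [in RHS]big_nat_recl// [in RHS]big_nat_recl//=.
by ring.
Qed.

(** * One time step *)

Lemma sum_sqr_pred (R : realType) (M : nat) (v : nat -> R) :
  \sum_(1 <= i < M) v i.-1 ^+ 2 <= autocorr M v 0.
Proof.
rewrite autocorr0; case: M => [|M]; first by rewrite !big_geq.
by rewrite big_add1 /= big_nat_recr//= lerDl sqr_ge0.
Qed.

Lemma sum_sqr_interior (R : realType) (M : nat) (v : nat -> R) :
  interior_supp M v -> \sum_(1 <= i < M) v i ^+ 2 = autocorr M v 0.
Proof. by move=> [v0 _]; rewrite autocorr0 sum_interior// v0 expr0n. Qed.

Lemma sum_sqr_succ (R : realType) (M : nat) (v : nat -> R) :
  interior_supp M v -> \sum_(1 <= i < M) v i.+1 ^+ 2 <= autocorr M v 0.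
Proof.
move=> sv; apply: le_trans (sum_sqr_shift _ _ 1 _ sv).
case: M {sv} => [|M]; first by rewrite !big_geq.
rewrite [leRHS]big_ltn// (eq_bigr (fun i => v (i + 1)%N ^+ 2)).
  by rewrite lerDr sqr_ge0.
by move=> i _; rewrite addn1.
Qed.

Lemma sum_sqr_compact_op (R : realType) (lambda h : R) (M : nat) (v : nat -> R) :
  0 <= lambda * h <= 1 / 2 -> interior_supp M v ->
  \sum_(1 <= i < M) compact_op lambda h v i ^+ 2 <= 6 * autocorr M v 0.
Proof.
move=> s01 sv; have [/andP[p1 p2] /andP[q1 q2] _] := expR_small _ _ s01.
have q0 := expR_gt0 (- (lambda * h)); have p0 := expR_gt0 (lambda * h).
have [s0 s1] : 0 <= lambda * h /\ lambda * h <= 1 / 2 by move: s01 => /andP[].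
apply: (@le_trans _ _ (\sum_(1 <= i < M)
    (2 * v i.-1 ^+ 2 + 2 * v i ^+ 2 + 2 * v i.+1 ^+ 2))).
  apply: ler_sum => i _; rewrite /compact_op.
  set p := expR (lambda * h) in p0 p1 p2 *; set q := expR _ in q0 q1 q2 *.
  set x := v i.-1; set y := v i; set z := v i.+1.
  have three (A B C : R) : (A + B + C) ^+ 2 <= 3 * (A ^+ 2 + B ^+ 2 + C ^+ 2).
    have := sqr_ge0 (A - B); have := sqr_ge0 (B - C); have := sqr_ge0 (A - C).
    by rewrite !expr2; lra.
  apply: le_trans (three _ _ _) _; rewrite !exprMn.
  have x0 := sqr_ge0 x; have y0 := sqr_ge0 y; have z0 := sqr_ge0 z.
  have ex : q ^+ 2 * x ^+ 2 <= 1 * x ^+ 2 by rewrite ler_wpM2r//; nra.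
  have ez : p ^+ 2 * z ^+ 2 <= 4 * z ^+ 2 by rewrite ler_wpM2r//; nra.
  lra.
rewrite !big_split/= -!mulr_sumr.
have := sum_sqr_pred _ M v; have := sum_sqr_succ _ _ _ sv.
by rewrite (sum_sqr_interior _ _ v)//; lra.
Qed.

Lemma sum_mul_le (R : realType) (M : nat) (c : R) (x y : nat -> R) : 0 < c ->
  \sum_(1 <= i < M) x i * y i
  <= c / 2 * (\sum_(1 <= i < M) x i ^+ 2) + (2 * c)^-1 * (\sum_(1 <= i < M) y i ^+ 2).
Proof.
move=> c0; rewrite !mulr_sumr -big_split/=; apply: ler_sum => i _.
have := sqr_ge0 (c * x i - y i).
have : 0 < (2 * c)^-1 by rewrite invr_gt0 mulr_gt0.
move=> ic sq; have : 0 <= (2 * c)^-1 * (c * x i - y i) ^+ 2 by rewrite mulr_ge0// ltW.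
rewrite (_ : (2 * c)^-1 * (c * x i - y i) ^+ 2 =
  c / 2 * x i ^+ 2 + (2 * c)^-1 * y i ^+ 2 - x i * y i); first by rewrite subr_ge0.
by field; rewrite gt_eqF.
Qed.

(* There is a loss in each step, but no smallness condition on tau alone: eta
   tends to 0 with h. *)
Lemma unweighted_step (R : realType) (alpha lambda h K tau eta : R) (M : nat)
    (e e' r : nat -> R) :
  interior_supp M e -> interior_supp M e' ->
  0 <= lambda * h <= 1 / 4 ->
  \sum_(1 <= i < M) e' i * discr_deriv alpha lambda h e' i
    <= eta * autocorr M e' 0 ->
  0 <= K * tau -> 0 <= tau -> K * tau * eta <= 1 / 8 ->
  (forall i, (1 <= i < M)%N -> compact_op lambda h e' i
     - K * tau * discr_deriv alpha lambda h e' i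
     = compact_op lambda h e i + tau * r i) ->
  autocorr M e' 0
  <= 768 * (autocorr M e 0 + tau ^+ 2 * (\sum_(1 <= i < M) r i ^+ 2)).
Proof.
move=> se se' s14 fle Kt0 tau0 Kteta eqn.
have s01 : 0 <= lambda * h <= 1 / 2 by move: s14 => /andP[-> ?]; lra.
have [/andP[p1 p2] /andP[q1 q2] _] := expR_small _ _ s01.
have E : \sum_(1 <= i < M) e' i * compact_op lambda h e' i
   - K * tau * (\sum_(1 <= i < M) e' i * discr_deriv alpha lambda h e' i)
   = \sum_(1 <= i < M) e' i * compact_op lambda h e i
   + tau * (\sum_(1 <= i < M) e' i * r i).
  rewrite !mulr_sumr -sumrB -big_split/= !big_nat; apply: eq_bigr => i iM.
  by rewrite mulrCA -mulrBr (eqn i iM); ring.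
move: E; rewrite sum_mul_compact_op//.
(* The compact form is at least (2/3 - 5/12) c_0, and K tau eta takes away 1/8. Two Young terms with
   parameter 1/16 take 1/32 each, so 1/16 is left; 768 is 16 * 8 * 6. *)
have := sum_mul_le R M (1 / 16) e' (compact_op lambda h e).
have := sum_mul_le R M (1 / 16) e' (fun i => tau * r i).
have -> : \sum_(1 <= i < M) e' i * (tau * r i) = tau * (\sum_(1 <= i < M) e' i * r i).
  by rewrite mulr_sumr; apply: eq_bigr => i _; rewrite mulrCA.
have -> : \sum_(1 <= i < M) (tau * r i) ^+ 2 = tau ^+ 2 * \sum_(1 <= i < M) r i ^+ 2.
  by rewrite mulr_sumr; apply: eq_bigr => i _; rewrite exprMn.
rewrite !(sum_sqr_interior _ _ e')//.
have := sum_sqr_compact_op R lambda h M e s01 se.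
have c0 := autocorr0_ge0 R M e'; have c1 := autocorr_geN R M 1 e' se'.
have g1 := ler_wpM2l Kt0 fle.
have g2 := ler_wpM2r c0 Kteta.
have pq : (expR (lambda * h) + expR (- (lambda * h))) / 6 <= 5 / 12.
  by move: s14 => /andP[]; lra.
have pq0 : 0 <= (expR (lambda * h) + expR (- (lambda * h))) / 6.
  by rewrite divr_ge0// addr_ge0// expR_ge0.
have g3 : - (5 / 12 * autocorr M e' 0) <=
    (expR (lambda * h) + expR (- (lambda * h))) / 6 * autocorr M e' 1.
  have := ler_wpM2l pq0 c1; have := ler_wpM2r c0 pq; lra.
move=> g4 g5 g6 g7.
have := g5 _; rewrite divr_gt0// => /(_ isT) {}g5.
have := g6 _; rewrite divr_gt0// => /(_ isT) {}g6.
have : 0 <= tau ^+ 2 * \sum_(1 <= i < M) r i ^+ 2.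
  by rewrite mulr_ge0 ?sqr_ge0// sumr_ge0// => i _; exact: sqr_ge0.
lra.
Qed.

(** * Exponential tilting and the weighted energy *)

Lemma expR_natSM (R : realType) (s : R) (i : nat) :
  expR (i.+1%:R * s) = expR (i%:R * s) * expR s.
Proof. by rewrite -natr1 mulrDl mul1r expRD. Qed.

Definition tilt {R : realType} (s : R) (v : nat -> R) (i : nat) : R :=
  expR (i%:R * s) * v i.

Lemma compact_op_tilt (R : realType) (lambda h : R) (v : nat -> R) (i : nat) :
  (0 < i)%N ->
  compact_op 0 h (tilt (lambda * h) v) i
  = expR (i%:R * (lambda * h)) * compact_op lambda h v i.
Proof.
case: i => [//|i] _; rewrite /compact_op /tilt /= !mul0r oppr0 expR0.
rewrite !expR_natSM expRN.
have := expR_gt0 (lambda * h); set p := expR (lambda * h) => p0.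
by field; rewrite gt_eqF.
Qed.

(** Conjugation by e^(lambda x) removes every tempering exponential; a skew centred difference and a
    multiple of the compact operator are split off from the fractional part. *)
Lemma discr_deriv_tilt (R : realType) (alpha lambda h : R) (v : nat -> R)
    (i : nat) : 1 < alpha -> (0 < i)%N ->
  expR (i%:R * (lambda * h)) * discr_deriv alpha lambda h v i
  = discr_deriv alpha 0 h (tilt (lambda * h) v) i
    - alpha * lambda `^ (alpha - 1) / (2 * h)
      * (tilt (lambda * h) v i.+1 - tilt (lambda * h) v i.-1)
    + lambda `^ alpha * (alpha - 1) * compact_op 0 h (tilt (lambda * h) v) i.
Proof.
move=> a1 i0; rewrite compact_op_tilt// /discr_deriv.
(* Powers of 0 with nonzero exponent vanish, so [discr_deriv alpha 0] is the fractional sum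
   alone. *)
rewrite powR0; last by rewrite gt_eqF//; lra.
rewrite powR0; last by rewrite gt_eqF//; lra.
rewrite mulr0 !mul0r subr0 addr0 [LHS]mulrDr [X in X + _ = _]mulrBr.
congr (_ - _ + _).
- rewrite mulrCA; congr (_ * _); rewrite mulr_sumr !big_nat.
  apply: eq_bigr => k /andP[_ ki].
  rewrite /tilt weightE [in RHS]weightE mul0r mulr0 expR0 mulr1.
  rewrite natrB// -[i.+1%:R]natr1.
  rewrite (_ : (i%:R + 1 - k%:R) * (lambda * h) =
    i%:R * (lambda * h) + (1 - k%:R) * (lambda * h)); last by ring.
  by rewrite expRD; ring.
- rewrite mulrCA; congr (_ * _); case: i i0 => [//|i] _; rewrite /tilt /=.
  rewrite !expR_natSM expRN.
  have := expR_gt0 (lambda * h); set p := expR (lambda * h) => p0.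
  by field; rewrite gt_eqF.
- by ring.
Qed.

Lemma interior_supp_tilt (R : realType) (s : R) (M : nat) (v : nat -> R) :
  interior_supp M v -> interior_supp M (tilt s v).
Proof.
move=> [v0 vM]; split=> [|i iM]; rewrite /tilt; first by rewrite v0 mulr0.
by rewrite vM// mulr0.
Qed.

Lemma compact_form_sym (R : realType) (h : R) (M : nat) (x y : nat -> R) :
  interior_supp M x -> interior_supp M y ->
  \sum_(1 <= i < M) x i * compact_op 0 h y i
  = \sum_(1 <= i < M) y i * compact_op 0 h x i.
Proof.
move=> [x0 xM] [y0 yM].
have swap (u w : nat -> R) : u 0%N = 0 -> w 0%N = 0 -> w M = 0 ->
    \sum_(1 <= i < M) u i * w i.+1 = \sum_(1 <= i < M) w i * u i.-1.
  move=> u0 w0 wM; rewrite !sum_interior ?u0 ?w0 ?mul0r//.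
  rewrite -(@sum_succ _ M (fun i => w i * u i.-1)) ?w0 ?wM ?mul0r//.
  by apply: eq_bigr => i _; rewrite mulrC.
rewrite /compact_op mul0r oppr0 expR0 !mulr1.
transitivity (1 / 6 * (\sum_(1 <= i < M) x i * y i.-1)
   + 2 / 3 * (\sum_(1 <= i < M) x i * y i)
   + 1 / 6 * (\sum_(1 <= i < M) x i * y i.+1)).
  by rewrite !mulr_sumr -!big_split/=; apply: eq_bigr => i _; ring.
rewrite (swap x y)// ?yM// -(swap y x)// ?xM//.
rewrite !mulr_sumr -!big_split/=; apply: eq_bigr => i _; ring.
Qed.

(** The energy of the weighted argument; by [compact_form_ge] it controls the sum of squares. *)
Definition compact_form {R : realType} (h : R) (M : nat) (v : nat -> R) : R :=
  \sum_(1 <= i < M) v i * compact_op 0 h v i.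

Lemma compact_form_ge (R : realType) (h : R) (M : nat) (v : nat -> R) :
  interior_supp M v -> autocorr M v 0 <= 3 * compact_form h M v.
Proof.
move=> sv; rewrite /compact_form sum_mul_compact_op// mul0r oppr0 expR0.
by have := autocorr_geN R M 1 v sv; lra.
Qed.

Lemma compact_form_ge0 (R : realType) (h : R) (M : nat) (v : nat -> R) :
  interior_supp M v -> 0 <= compact_form h M v.
Proof.
by move=> sv; have := compact_form_ge R h M v sv; have := autocorr0_ge0 R M v; lra.
Qed.

(** Positivity of the form at x - y together with its symmetry. Measuring both factors in the energy
    itself loses no constant, as growth 1 + O(tau) requires. *)
Lemma compact_form_young (R : realType) (h : R) (M : nat) (x y : nat -> R) :
  interior_supp M x -> interior_supp M y ->
  \sum_(1 <= i < M) x i * compact_op 0 h y i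
  <= (compact_form h M x + compact_form h M y) / 2.
Proof.
move=> sx sy.
have sd : interior_supp M (fun i => x i - y i).
  move: sx sy => [x0 xM] [y0 yM]; split=> [|i iM]; first by rewrite x0 y0 subrr.
  by rewrite xM// yM// subrr.
have := compact_form_ge0 R h M _ sd.
have -> : compact_form h M (fun i => x i - y i) = compact_form h M x
    + compact_form h M y - \sum_(1 <= i < M) x i * compact_op 0 h y i
    - \sum_(1 <= i < M) y i * compact_op 0 h x i.
  rewrite /compact_form -big_split -!sumrB /=; apply: eq_bigr => i _.
  by rewrite /compact_op; ring.
rewrite -(compact_form_sym _ _ _ _ _ sx sy); lra.
Qed.

Lemma sum_mul_centred_diff (R : realType) (M : nat) (v : nat -> R) :
  interior_supp M v -> \sum_(1 <= i < M) v i * (v i.+1 - v i.-1) = 0.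
Proof.
move=> sv; have [v0 _] := sv.
rewrite sum_interior ?v0 ?mul0r//.
under eq_bigr do rewrite mulrBr; rewrite sumrB sum_mul_pred//.
by apply/eqP; rewrite subr_eq0; apply/eqP; apply: eq_bigr => i _; rewrite addn1.
Qed.

(* The tilt symmetrizes the compact operator, which lets the energy be compared
   with constant 1 + O(tau). *)
Lemma weighted_step (R : realType) (alpha lambda h K tau : R) (M : nat)
    (e e' r : nat -> R) :
  let W := tilt (lambda * h) in
  let c := 2 * (K * (lambda `^ alpha * (alpha - 1))) + 3 in
  1 < alpha < 2 -> 0 < h -> 0 <= K -> 0 <= tau -> tau * c <= 1 / 2 ->
  interior_supp M e -> interior_supp M e' ->
  (forall i, (1 <= i < M)%N -> compact_op lambda h e' i
     - K * tau * discr_deriv alpha lambda h e' i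
     = compact_op lambda h e i + tau * r i) ->
  compact_form h M (W e')
  <= (1 + 2 * (tau * c)) * (compact_form h M (W e)
       + tau * (\sum_(1 <= i < M) (W r i) ^+ 2)).
Proof.
move=> W c a12 h0 K0 tau0 tauc se se' eqn; have /andP[a1 a2] := a12.
have sW := interior_supp_tilt _ (lambda * h) _ _ se.
have sW' := interior_supp_tilt _ (lambda * h) _ _ se'.
set L := lambda `^ alpha * (alpha - 1) in c tauc *.
have L0 : 0 <= L by rewrite mulr_ge0 ?powR_ge0// subr_ge0 ltW.
have E : compact_form h M (W e') - K * tau * (
      \sum_(1 <= i < M) W e' i * discr_deriv alpha 0 h (W e') i
      - alpha * lambda `^ (alpha - 1) / (2 * h)
        * (\sum_(1 <= i < M) W e' i * (W e' i.+1 - W e' i.-1))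
      + L * compact_form h M (W e'))
   = \sum_(1 <= i < M) W e' i * compact_op 0 h (W e) i
   + tau * (\sum_(1 <= i < M) W e' i * W r i).
  rewrite /compact_form !mulr_sumr -sumrB -big_split/= !mulr_sumr -sumrB -big_split/=.
  rewrite !big_nat; apply: eq_bigr => i iM; have /andP[i0 _] := iM.
  have dt := discr_deriv_tilt R alpha lambda h e' i a1 i0.
  have -> : discr_deriv alpha 0 h (W e') i
      = expR (i%:R * (lambda * h)) * discr_deriv alpha lambda h e' i
      + alpha * lambda `^ (alpha - 1) / (2 * h) * (W e' i.+1 - W e' i.-1)
      - L * compact_op 0 h (W e') i by rewrite dt /L /W; ring.
  rewrite /W !compact_op_tilt// [tilt _ r i]/tilt.
  have -> : compact_op lambda h e' i
      = K * tau * discr_deriv alpha lambda h e' i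
        + (compact_op lambda h e i + tau * r i) by rewrite -(eqn i iM); ring.
  by ring.
move: E; rewrite sum_mul_centred_diff// mulr0 subr0.
(* For lambda = 0 the bound of [discr_deriv_form_le] is zero. *)
have form0 : \sum_(1 <= i < M) W e' i * discr_deriv alpha 0 h (W e') i <= 0.
  have [w1 w2] := weight_01_gt0 R alpha a12.
  have := discr_deriv_form_le R alpha 0 h M (W e') a12.
  by rewrite !mul0r mulr0 mul0r; apply=> //; exact: ltW.
have y1 := compact_form_young R h M (W e') (W e) sW' sW.
have := sum_mul_le R M 1 (W e') (W r) ltr01.
rewrite (sum_sqr_interior _ _ (W e'))//.
have := compact_form_ge R h M _ sW'.
have b0 := compact_form_ge0 R h M _ sW; have b0' := compact_form_ge0 R h M _ sW'.
set rho := \sum_(1 <= i < M) W r i ^+ 2.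
have rho0 : 0 <= rho by apply: sumr_ge0 => i _; exact: sqr_ge0.
set b := compact_form h M (W e) in b0 y1 *.
set b' := compact_form h M (W e') in b0' y1 *.
set F := \sum_(1 <= i < M) W e' i * discr_deriv alpha 0 h (W e') i in form0 *.
set X := \sum_(1 <= i < M) W e' i * compact_op 0 h (W e) i in y1 *.
set Y := \sum_(1 <= i < M) W e' i * W r i.
move=> cge yle E.
have KtF : K * tau * F <= 0 by rewrite mulr_ge0_le0// mulr_ge0.
have tY : tau * Y <= tau * (3 / 2 * b' + rho / 2) by rewrite ler_wpM2l//; lra.
(* Twice the energy identity: [2 * K * L] comes from the zeroth-order term, and 3 from Young's
   inequality combined with [compact_form_ge]. *)
have main : (1 - tau * c) * b' <= b + tau * rho.
  have e1 : tau * c * b' = 2 * (K * tau * (L * b')) + 3 * (tau * b').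
    by rewrite /c; ring.
  lra.
have c0 : 0 <= tau * c by rewrite mulr_ge0// /c addr_ge0// mulr_ge0// mulr_ge0.
have br0 : 0 <= b + tau * rho by rewrite addr_ge0// mulr_ge0.
set y := tau * c in tauc c0 main *.
(* For 0 <= y <= 1/2 one has (1 + 2 y) (1 - y) = 1 + y (1 - 2 y) >= 1, which inverts 1 - y. *)
have y12 : 0 <= 1 + 2 * y by lra.
have := ler_wpM2l y12 main.
have : 0 <= y * (1 - 2 * y) * b' by rewrite mulr_ge0// mulr_ge0//; lra.
lra.
Qed.

(** * The error on a grid *)

(** The crude factor N is harmless: either P carries a factor tau, or the number of steps is
    bounded. *)
Lemma discrete_gronwall (R : realType) (A : nat -> R) (G P : R) (N : nat) :
  1 <= G -> 0 <= P -> A 0%N <= 0 ->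
  (forall n, (n < N)%N -> A n.+1 <= G * (A n + P)) ->
  forall n, (n <= N)%N -> A n <= N%:R * G ^+ N * P.
Proof.
move=> G1 P0 A0 step n nN.
have G0 : 0 <= G by apply: le_trans G1.
apply: (@le_trans _ _ (n%:R * G ^+ n * P)); last first.
  rewrite ler_wpM2r// ler_pM ?exprn_ge0 ?ler_nat//.
  by rewrite ler_weXn2l.
elim: n nN => [|n ih] nN; first by rewrite !mul0r.
apply: le_trans (step n nN) _.
rewrite exprS -natr1 (_ : (n%:R + 1) * (G * G ^+ n) * P =
   G * (n%:R * G ^+ n * P + G ^+ n * P)); last by ring.
rewrite ler_wpM2l// lerD// ?ih ?(ltnW nN)//.
by rewrite ler_peMl// exprn_ege1.
Qed.

Lemma compact_opB (R : realType) (lambda h : R) (M i : nat) (v x y : nat -> R) :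
  (forall j, (j <= M)%N -> v j = x j - y j) -> (i < M)%N ->
  compact_op lambda h v i = compact_op lambda h x i - compact_op lambda h y i.
Proof.
move=> vxy iM; rewrite /compact_op !vxy ?(ltnW iM)//; first by ring.
exact: leq_trans (leq_pred i) (ltnW iM).
Qed.

Lemma discr_derivB (R : realType) (alpha lambda h : R) (M i : nat)
    (v x y : nat -> R) :
  (forall j, (j <= M)%N -> v j = x j - y j) -> (i < M)%N ->
  discr_deriv alpha lambda h v i
  = discr_deriv alpha lambda h x i - discr_deriv alpha lambda h y i.
Proof.
move=> vxy iM; rewrite /discr_deriv (compact_opB _ _ _ _ _ _ _ _ vxy iM).
rewrite (eq_bigr (fun k => weight alpha lambda h k * x (i.+1 - k)%N
    - weight alpha lambda h k * y (i.+1 - k)%N)); last first.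
  move=> k _; rewrite vxy ?mulrBr//.
  exact: leq_trans (leq_subr _ _) iM.
rewrite sumrB !vxy//; first by ring.
exact: leq_trans (leq_pred i) (ltnW iM).
Qed.

Section error.
Variables (R : realType) (a b T alpha lambda K : R).
Variables (u0 ub : R -> R) (f u : R -> R -> R).
Hypotheses (hab : a < b) (hT : 0 < T) (halpha : 1 < alpha < 2).
Hypotheses (hlambda : 0 <= lambda) (hK : 0 <= K).
Hypothesis (hsol : is_solution a b T alpha lambda K u0 ub f u).
Variables (M N : nat) (U : nat -> nat -> R).
Hypotheses (hM : (0 < M)%N) (hN : (0 < N)%N).

Let h := (b - a) / M%:R.
Let tau := T / N%:R.

Hypothesis (hU : solves_scheme a alpha lambda K h tau u0 ub f M N U).

Let M0 : 0 < M%:R :> R. Proof. by rewrite ltr0n. Qed.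
Let N0 : 0 < N%:R :> R. Proof. by rewrite ltr0n. Qed.
Let h0 : 0 < h. Proof. by rewrite divr_gt0// subr_gt0. Qed.
Let tau0 : 0 < tau. Proof. exact: divr_gt0. Qed.
Let Mh : M%:R * h = b - a.
Proof. by rewrite mulrC divfK// gt_eqF. Qed.
Let Ntau : N%:R * tau = T.
Proof. by rewrite mulrC divfK// gt_eqF. Qed.

(** Cut off at M because the scheme says nothing about U beyond M; at M itself the difference is 0
    by the boundary condition. *)
Definition error (n i : nat) : R :=
  if (i < M)%N then sample a h tau u n i - U n i else 0.

(** The defining relation solved for the residual, which is possible as tau > 0. *)
Definition trunc_error (n i : nat) : R :=
  (compact_op lambda h (sample a h tau u n.+1) i
   - compact_op lambda h (sample a h tau u n) i
   - K * tau * discr_deriv alpha lambda h (sample a h tau u n.+1) i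
   - tau * compact_op lambda h (sample a h tau f n.+1) i) / tau.

Lemma trunc_errorP n i :
  is_trunc_error a alpha lambda K h tau f u n i (trunc_error n i).
Proof.
rewrite /is_trunc_error /trunc_error.
by rewrite [tau * (_ / tau)]mulrC divfK ?gt_eqF//; ring.
Qed.

Lemma gridt_itv n : (n <= N)%N -> 0 <= gridt tau n <= T.
Proof.
move=> nN; rewrite /gridt mulr_ge0 ?(ltW tau0)//= -Ntau.
by rewrite ler_wpM2r ?(ltW tau0)// ler_nat.
Qed.

Lemma gridx_itv i : (i <= M)%N -> a <= gridx a h i <= b.
Proof.
move=> iM; rewrite /gridx lerDl mulr_ge0 ?(ltW h0)//=.
by rewrite -lerBrDl -Mh ler_wpM2r ?(ltW h0)// ler_nat.
Qed.

Lemma errorE n i : (n <= N)%N -> (i <= M)%N ->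
  error n i = sample a h tau u n i - U n i.
Proof.
move=> nN; rewrite leq_eqVlt => /predU1P[->|iM]; last by rewrite /error iM.
have [_ _ _ _ ubE] := hsol; have [_ _ _ UM] := hU.
have gM : gridx a h M = b by rewrite /gridx Mh addrC subrK.
rewrite /error ltnn UM// /sample gM ubE ?subrr//.
exact: gridt_itv.
Qed.

Lemma error_supp n : (n <= N)%N -> interior_supp M (error n).
Proof.
move=> nN; split; last by move=> i Mi; rewrite /error ltnNge Mi.
have [_ _ _ uaE _] := hsol; have [_ _ U0 _] := hU.
rewrite errorE// U0// /sample /gridx mul0r addr0 uaE ?subrr//.
exact: gridt_itv.
Qed.

Lemma error0 i : error 0 i = 0.
Proof.
rewrite /error; case: ifP => // iM.
have [_ _ u0E _ _] := hsol; have [_ U0 _ _] := hU.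
rewrite U0 ?(ltnW iM)// /sample /gridt mul0r u0E ?subrr//.
exact: gridx_itv (ltnW iM).
Qed.

Lemma error_eqn n i : (n < N)%N -> (1 <= i < M)%N ->
  compact_op lambda h (error n.+1) i
  - K * tau * discr_deriv alpha lambda h (error n.+1) i
  = compact_op lambda h (error n) i + tau * trunc_error n i.
Proof.
move=> nN iM; have [UE _ _ _] := hU; have /andP[_ iM'] := iM.
have eE m (mN : (m <= N)%N) j : (j <= M)%N ->
  error m j = sample a h tau u m j - U m j by exact: errorE.
rewrite !(compact_opB _ _ _ _ _ _ _ _ (eE n.+1 nN) iM').
rewrite !(compact_opB _ _ _ _ _ _ _ _ (eE n (ltnW nN)) iM').
rewrite !(discr_derivB _ _ _ _ _ _ _ _ _ (eE n.+1 nN) iM').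
have := UE n i nN iM; have := trunc_errorP n i; rewrite /is_trunc_error /=.
by lra.
Qed.

Lemma grid_norm_error n : (n <= N)%N ->
  grid_norm h M (fun i => sample a h tau u n i - U n i)
  = Num.sqrt (h * autocorr M (error n) 0).
Proof.
move=> nN; rewrite /grid_norm -(sum_sqr_interior _ _ _ (error_supp n nN)).
congr (Num.sqrt (h * _)); rewrite !big_nat; apply: eq_bigr => i /andP[_ iM].
by rewrite errorE// ltnW.
Qed.

Variable eps : R.
Hypothesis eps0 : 0 <= eps.
Hypothesis trunc_le : forall n i, (n < N)%N -> (1 <= i < M)%N ->
  `|trunc_error n i| <= eps.

Lemma sum_trunc_le n (c : nat -> R) (C : R) : (n < N)%N ->
  (forall i, (i < M)%N -> 0 <= c i <= C) ->
  \sum_(1 <= i < M) (c i * trunc_error n i) ^+ 2 <= M%:R * (C * eps) ^+ 2.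
Proof.
move=> nN cC; apply: (@le_trans _ _ (\sum_(1 <= i < M) (C * eps) ^+ 2)).
  rewrite !big_nat; apply: ler_sum => i iM; have /andP[_ iM'] := iM.
  have /andP[c0 c1] := cC i iM'.
  rewrite -[leLHS]real_normK ?num_real// normrM (ger0_norm c0).
  rewrite lerXn2r ?nnegrE ?mulr_ge0 ?(le_trans c0 c1)//.
  by apply: ler_pM => //; exact: trunc_le.
rewrite sumr_const_nat -[leLHS]mulr_natl ler_wpM2r ?sqr_ge0// ler_nat.
exact: leq_subr.
Qed.

Lemma sqrt_error_le n (B : R) : (n <= N)%N -> 0 <= B ->
  h * autocorr M (error n) 0 <= B * eps ^+ 2 ->
  grid_norm h M (fun i => sample a h tau u n i - U n i) <= Num.sqrt B * eps.
Proof.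
move=> nN B0 le_e; rewrite grid_norm_error//.
rewrite -[X in _ <= _ * X](ger0_norm eps0) -sqrtr_sqr -sqrtrM//.
by rewrite ler_wsqrtr.
Qed.

(** Gronwall for the tilted error: 3 is the coercivity constant, e^(2Tc) bounds (1 + 2 tau c)^N, and
    the last exponential bounds the tilt of the truncation error. Undoing the tilt on the left is
    free because its factors are at least 1. *)
Lemma error_le_small_tau n :
  let c := 2 * (K * (lambda `^ alpha * (alpha - 1))) + 3 in
  tau * c <= 1 / 2 -> (n <= N)%N ->
  grid_norm h M (fun i => sample a h tau u n i - U n i)
  <= Num.sqrt (3 * T * expR (2 * (T * c)) * (b - a) * expR (lambda * (b - a)) ^+ 2)
     * eps.
Proof.
move=> c tauc nN; set E := expR (lambda * (b - a)).
have c0 : 0 <= c.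
  rewrite addr_ge0// mulr_ge0// mulr_ge0// mulr_ge0 ?powR_ge0//.
  by move: halpha => /andP[? _]; lra.
have tauc0 : 0 <= tau * c by rewrite mulr_ge0// ltW.
apply: sqrt_error_le => //.
  by rewrite !mulr_ge0 ?expR_ge0 ?exprn_ge0// ?subr_ge0 ?ltW.
have tiltE i : (i < M)%N -> 0 <= expR (i%:R * (lambda * h)) <= E.
  move=> iM; rewrite expR_ge0 ler_expR mulrCA -Mh ler_wpM2l//.
  by rewrite ler_wpM2r ?(ltW h0)// ler_nat ltnW.
have step m : (m < N)%N -> compact_form h M (tilt (lambda * h) (error m.+1))
    <= (1 + 2 * (tau * c)) * (compact_form h M (tilt (lambda * h) (error m))
       + tau * (M%:R * (E * eps) ^+ 2)).
  move=> mN.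
  have := weighted_step R alpha lambda h K tau M (error m) (error m.+1)
    (trunc_error m) halpha h0 hK (ltW tau0) tauc
    (error_supp _ (ltnW mN)) (error_supp _ mN) (fun i => error_eqn m i mN).
  move=> /le_trans; apply; rewrite ler_wpM2l//; first by rewrite addr_ge0// mulr_ge0.
  by rewrite lerD2l ler_wpM2l ?(ltW tau0)// sum_trunc_le.
have P0 : 0 <= tau * (M%:R * (E * eps) ^+ 2).
  exact: mulr_ge0 (ltW tau0) (mulr_ge0 (ler0n _ _) (sqr_ge0 _)).
have A0 : compact_form h M (tilt (lambda * h) (error 0)) <= 0.
  rewrite /compact_form big1// => i _.
  by rewrite /tilt error0 mulr0 mul0r.
have G1 : 1 <= 1 + 2 * (tau * c) by rewrite lerDl mulr_ge0.
have := discrete_gronwall R _ _ _ _ G1 P0 A0 step n nN.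
have := compact_form_ge R h M _ (interior_supp_tilt _ (lambda * h) _ _ (error_supp n nN)).
have GN : (1 + 2 * (tau * c)) ^+ N <= expR (2 * (T * c)).
  rewrite -Ntau (_ : 2 * (N%:R * tau * c) = N%:R * (2 * (tau * c))); last by ring.
  rewrite expRM_natl lerXn2r ?nnegrE ?expR_ge0 ?expR_ge1Dx//.
  by rewrite addr_ge0// mulr_ge0.
have eW : autocorr M (error n) 0 <= autocorr M (tilt (lambda * h) (error n)) 0.
  rewrite !autocorr0; apply: ler_sum => i _; rewrite /tilt exprMn ler_peMl ?sqr_ge0//.
  by rewrite exprn_ege1// -expR0 ler_expR mulr_ge0// mulr_ge0// ltW.
move=> fge gron.
have hE : h * (N%:R * expR (2 * (T * c)) * (tau * (M%:R * (E * eps) ^+ 2)))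
    = T * expR (2 * (T * c)) * (b - a) * E ^+ 2 * eps ^+ 2.
  by rewrite -Ntau -Mh; ring.
have : h * autocorr M (error n) 0 <=
    3 * (h * (N%:R * expR (2 * (T * c)) * (tau * (M%:R * (E * eps) ^+ 2)))).
  rewrite mulrCA ler_wpM2l ?(ltW h0)//; apply: le_trans eW _; apply: le_trans fge _.
  rewrite ler_wpM2l//; apply: le_trans gron _.
  by rewrite ler_wpM2r// ler_wpM2l.
by rewrite hE => /le_trans; apply; rewrite le_eqVlt; apply/orP; left; apply/eqP; ring.
Qed.

(** At most [N1] applications of [unweighted_step], with tau <= T; the factor b - a is M h. *)
Lemma error_le_small_h n (N1 : nat) :
  let cw := @weight R alpha 0 0 in
  lambda * h <= 1 / 4 ->
  lambda * h * (`|cw 2%N| + 3) <= cw 0%N + cw 2%N ->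
  lambda * h * (`|cw 2%N| + 3) <= cw 0%N + cw 2%N + 4 * cw 3%N ->
  K * T * (5 * lambda `^ alpha * (lambda * h)) <= 1 / 8 ->
  (N <= N1)%N -> (n <= N)%N ->
  grid_norm h M (fun i => sample a h tau u n i - U n i)
  <= Num.sqrt (N1%:R * 768 ^+ N1 * T ^+ 2 * (b - a)) * eps.
Proof.
move=> cw s14 d1 d2 eta8 NN1 nN.
have s0 : 0 <= lambda * h by rewrite mulr_ge0// ltW.
have [G G768 G1] : exists2 G : R, G = 768 & 1 <= G.
  by exists 768 => //; rewrite ler1n.
have G0 : 0 <= G by exact: le_trans G1.
rewrite -G768.
apply: sqrt_error_le => //.
  by rewrite !mulr_ge0 ?exprn_ge0// ?subr_ge0 ?ltW.
have tauT : tau <= T by rewrite ler_pdivrMr// ler_peMr ?ler1n// ltW.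
have step m : (m < N)%N -> autocorr M (error m.+1) 0
    <= G * (autocorr M (error m) 0 + T ^+ 2 * (M%:R * eps ^+ 2)).
  move=> mN.
  have eta : K * tau * (5 * lambda `^ alpha * (lambda * h)) <= 1 / 8.
    apply: le_trans eta8; rewrite ler_wpM2r//; last by rewrite ler_wpM2l.
    by apply: mulr_ge0 s0; apply: mulr_ge0 (powR_ge0 _ _).
  have sE := error_supp _ mN.
  have form : \sum_(1 <= i < M) error m.+1 i
      * discr_deriv alpha lambda h (error m.+1) i
      <= 5 * lambda `^ alpha * (lambda * h) * autocorr M (error m.+1) 0.
    by apply: discr_deriv_form_le => //; lra.
  have := unweighted_step R alpha lambda h K tau _ M (error m) (error m.+1)
    (trunc_error m) (error_supp _ (ltnW mN)) sE _ form (mulr_ge0 hK (ltW tau0))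
    (ltW tau0) eta (fun i => error_eqn m i mN).
  rewrite s0 s14 -G768 => /(_ isT) /le_trans; apply.
  rewrite ler_wpM2l// lerD2l ler_pM ?sqr_ge0//.
  - by apply: sumr_ge0 => i _; exact: sqr_ge0.
  - by rewrite lerXn2r ?nnegrE ?(ltW hT) ?(ltW tau0).
  - rewrite -[eps]mul1r (eq_bigr (fun i => (1 * trunc_error m i) ^+ 2)).
      by apply: (sum_trunc_le m (fun=> 1)) => // i _; rewrite ler01 lexx.
    by move=> i _; rewrite mul1r.
have P0 : 0 <= T ^+ 2 * (M%:R * eps ^+ 2).
  exact: mulr_ge0 (sqr_ge0 _) (mulr_ge0 (ler0n _ _) (sqr_ge0 _)).
have A0 : autocorr M (error 0) 0 <= 0.
  by rewrite autocorr0 big1// => i _; rewrite error0 expr0n.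
have gron := discrete_gronwall R (fun m => autocorr M (error m) 0) _ _ _
  G1 P0 A0 step n nN.
have N1E : N%:R * G ^+ N <= N1%:R * G ^+ N1.
  by rewrite ler_pM ?exprn_ge0 ?ler_nat// ler_weXn2l.
apply: (@le_trans _ _ (h * (N1%:R * G ^+ N1 * (T ^+ 2 * (M%:R * eps ^+ 2))))).
  rewrite ler_wpM2l ?(ltW h0)//; apply: le_trans gron _.
  by rewrite ler_wpM2r.
by rewrite -Mh le_eqVlt; apply/orP; left; apply/eqP; ring.
Qed.

End error.

(* By uniqueness all admissible U agree on the grid, so that one constant serves
   them all; it is 0 when there is no such U. *)
Lemma fixed_grid_error (R : realType) (a alpha lambda K h tau : R)
    (u0 ub : R -> R) (f u : R -> R -> R) (M N : nat) : 0 < tau -> 0 < h ->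
  exists C : R, 0 <= C /\ forall U : nat -> nat -> R,
    is_scheme_solution a alpha lambda K h tau u0 ub f M N U ->
    forall n, (n <= N)%N ->
      grid_norm h M (fun i => sample a h tau u n i - U n i)
      <= C * (tau + h ^+ 3).
Proof.
move=> tau0 h0; have th0 : 0 < tau + h ^+ 3 by rewrite addr_gt0// exprn_gt0.
have [[U0 hU0]|noU] := pselect (exists U,
    is_scheme_solution a alpha lambda K h tau u0 ub f M N U); last first.
  by exists 0; split=> // U hU; case: noU; exists U.
pose err U n := grid_norm h M (fun i => sample a h tau u n i - U n i).
exists ((\sum_(n < N.+1) err U0 n) / (tau + h ^+ 3)); split.
  by rewrite divr_ge0 ?(ltW th0)// sumr_ge0// => n _; rewrite sqrtr_ge0.
move=> U hU n nN; rewrite divfK ?gt_eqF//.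
have -> : grid_norm h M (fun i => sample a h tau u n i - U n i) = err U0 n.
  rewrite /err /grid_norm; congr (Num.sqrt (h * _)).
  rewrite !big_nat; apply: eq_bigr => i /andP[_ iM].
  by have [_ uniq] := hU0; rewrite (uniq U hU.1 n i nN (ltnW iM)).
rewrite (bigD1 (Ordinal (nN : (n < N.+1)%N)))//= lerDl sumr_ge0// => m _.
by rewrite sqrtr_ge0.
Qed.

(** * Uniform constants and the three regimes *)

(** The sum of finitely many nonnegative constants dominates each of them, and P is monotone in its
    constant. *)
Lemma bounded_family_sup (R : realType) (P : nat -> nat -> R -> Prop)
    (m n : nat) :
  (forall M N C C', P M N C -> C <= C' -> P M N C') ->
  (forall M N, exists C, 0 <= C /\ P M N C) ->
  exists C, 0 <= C /\ forall M N, (M < m)%N -> (N < n)%N -> P M N C.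
Proof.
move=> mono exC.
have /choice [F FP] : forall MN : nat * nat, exists C, 0 <= C /\ P MN.1 MN.2 C.
  by move=> [M N]; exact: exC.
exists (\sum_(i < m) \sum_(j < n) F (i : nat, j : nat)); split.
  by apply: sumr_ge0 => i _; apply: sumr_ge0 => j _; have [] := FP (i : nat, j : nat).
move=> M N Mm Nn; apply: (mono _ _ (F (M, N))); first by have [] := FP (M, N).
have F0 i j : 0 <= F (i, j) by have [] := FP (i, j).
rewrite (bigD1 (Ordinal Mm))//= (bigD1 (Ordinal Nn))//= -addrA lerDl addr_ge0//.
  by apply: sumr_ge0.
by apply: sumr_ge0 => i _; apply: sumr_ge0.
Qed.

(** Each condition is linear in s with a positive bound, so a minimum of four thresholds works; B +
    1 avoids division by 0. *)
Lemma small_threshold (R : realType) (alpha B : R) :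
  let cw := @weight R alpha 0 0 in
  1 < alpha < 2 -> 0 <= B ->
  exists2 s0 : R, 0 < s0 & forall s, 0 <= s -> s <= s0 ->
    [/\ s <= 1 / 4, s * (`|cw 2%N| + 3) <= cw 0%N + cw 2%N,
        s * (`|cw 2%N| + 3) <= cw 0%N + cw 2%N + 4 * cw 3%N & B * s <= 1 / 8].
Proof.
move=> cw a12 B0; have [w1 w2] := weight_01_gt0 R alpha a12.
rewrite -/cw in w1 w2; set d := `|cw 2%N| + 3.
have d0 : 0 < d by rewrite ltr_wpDl.
have B1 : 0 < B + 1 by rewrite ltr_wpDl.
exists (Num.min (Num.min (1 / 4) ((cw 0%N + cw 2%N) / d))
  (Num.min ((cw 0%N + cw 2%N + 4 * cw 3%N) / d) (1 / 8 / (B + 1)))).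
  by rewrite !lt_min !divr_gt0.
move=> s s0; rewrite !le_min => /andP[/andP[s1 s2] /andP[s3 s4]].
split=> //; first by rewrite -ler_pdivlMr.
  by rewrite -ler_pdivlMr.
move: s4; rewrite ler_pdivlMr//; lra.
Qed.

Theorem theorem3p3 (R : realType) (a b T alpha lambda K : R)
    (u0 ub : R -> R) (f u : R -> R -> R)
    (hab : a < b) (hT : 0 < T) (halpha : 1 < alpha < 2)
    (hlambda : 0 <= lambda) (hK : 0 <= K)
    (hsol : is_solution a b T alpha lambda K u0 ub f u)
    (hreg : sufficiently_regular a b T alpha lambda K u0 ub f u) :
  exists C : R, forall M N : nat, (0 < M)%N -> (0 < N)%N ->
    let h := (b - a) / M%:R in
    let tau := T / N%:R in
    forall U : nat -> nat -> R,
      is_scheme_solution a alpha lambda K h tau u0 ub f M N U ->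
      forall n : nat, (1 <= n <= N)%N ->
        grid_norm h M (fun i => sample a h tau u n i - U n i)
          <= C * (tau + h ^+ 3).
Proof.
have [_ [C1 trunc_le]] := hreg.
pose c := 2 * (K * (lambda `^ alpha * (alpha - 1))) + 3.
pose B := K * T * (5 * lambda `^ alpha).
have B0 : 0 <= B.
  by apply: mulr_ge0; [exact: mulr_ge0 (ltW hT)|exact: mulr_ge0 (powR_ge0 _ _)].
have [s0 s00 small] := small_threshold R alpha B halpha B0.
(* If lambda h > s0 then M < m, and if tau c > 1/2 then N < [n1]: only finitely many grids escape
   the two stability estimates. *)
pose m := (Num.truncn (lambda * (b - a) / s0)).+1.
pose n1 := (Num.truncn (2 * T * c)).+1.
have c0 : 0 <= c.
  rewrite addr_ge0// mulr_ge0// mulr_ge0// mulr_ge0 ?powR_ge0//.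
  by move: halpha => /andP[? _]; lra.
pose P M N C := (0 < M)%N -> (0 < N)%N ->
  let h := (b - a) / M%:R in let tau := T / N%:R in
  forall U, is_scheme_solution a alpha lambda K h tau u0 ub f M N U ->
  forall n, (n <= N)%N -> grid_norm h M (fun i => sample a h tau u n i - U n i)
      <= C * (tau + h ^+ 3).
have th0 M N : (0 < M)%N -> (0 < N)%N -> 0 < T / N%:R + ((b - a) / M%:R) ^+ 3.
  by move=> M0 N0; rewrite addr_gt0 ?exprn_gt0 ?divr_gt0 ?subr_gt0 ?ltr0n.
have [C3 [C30 fin]] : exists C, 0 <= C /\ forall M N, (M < m)%N -> (N < n1)%N -> P M N C.
  apply: bounded_family_sup => [M N C C' PC CC' M0 N0 h tau U hU n nN|M N].
    apply: le_trans (PC M0 N0 U hU n nN) _; rewrite ler_wpM2r// ltW//.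
    exact: th0.
  have [M0|] := posnP M; first by exists 0; split=> //; rewrite /P M0.
  have [N0 _|N0 M0] := posnP N; first by exists 0; split=> //; rewrite /P N0.
  have [||C [C0 CP]] := fixed_grid_error R a alpha lambda K ((b - a) / M%:R)
    (T / N%:R) u0 ub f u M N.
  - by rewrite divr_gt0 ?ltr0n.
  - by rewrite divr_gt0 ?ltr0n ?subr_gt0.
  - by exists C; split=> // _ _ h tau; exact: CP.
set S1 := Num.sqrt (3 * T * expR (2 * (T * c)) * (b - a)
  * expR (lambda * (b - a)) ^+ 2).
set S2 := Num.sqrt (n1%:R * 768 ^+ n1 * T ^+ 2 * (b - a)).
exists ((S1 + S2) * `|C1| + C3) => M N M0 N0 h tau U hU n /andP[_ nN].
have MR0 : 0 < M%:R :> R by rewrite ltr0n.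
have NR0 : 0 < N%:R :> R by rewrite ltr0n.
have h0 : 0 < h by rewrite divr_gt0// subr_gt0.
have t0 : 0 < tau + h ^+ 3 by exact: th0.
(* The regularity hypothesis gives no sign for [C1], hence the absolute value. *)
pose eps := `|C1| * (tau + h ^+ 3).
have eps0 : 0 <= eps by rewrite mulr_ge0// ltW.
have trunc k i : (k < N)%N -> (1 <= i < M)%N ->
    `|trunc_error R a b T alpha lambda K f u M N k i| <= eps.
  move=> kN iM.
  apply: (@le_trans _ _ (C1 * (tau + h ^+ 3))); last first.
    by rewrite ler_wpM2r ?(ltW t0)// ler_norm.
  by apply: (trunc_le M N M0 N0 k i _ kN iM); exact: trunc_errorP.
have S10 : 0 <= S1 by exact: sqrtr_ge0.
have S20 : 0 <= S2 by exact: sqrtr_ge0.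
have le_C (D : R) : D <= (S1 + S2) * `|C1| + C3 ->
    D * (tau + h ^+ 3) <= ((S1 + S2) * `|C1| + C3) * (tau + h ^+ 3).
  by move=> DC; rewrite ler_wpM2r// ltW.
have C10 := normr_ge0 C1.
have S1C : 0 <= S1 * `|C1| by exact: mulr_ge0.
have S2C : 0 <= S2 * `|C1| by exact: mulr_ge0.
(* Small tau uses [S1]. Otherwise N is bounded, and small h uses [S2]. Otherwise M is bounded as
   well, and [C3] applies. *)
have [tauc|tauc] := leP (tau * c) (1 / 2).
  have := error_le_small_tau R a b T alpha lambda K u0 ub f u hab hT halpha
    hlambda hK hsol M N U M0 N0 hU.1 eps eps0 trunc n tauc nN.
  move=> /le_trans; apply.
  rewrite [leLHS](_ : _ = S1 * `|C1| * (tau + h ^+ 3)); last exact: mulrA.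
  by apply: le_C; rewrite mulrDl; lra.
have Nn1 : (N < n1)%N.
  rewrite ltnS truncn_ge_nat; last first.
    by rewrite mulr_ge0// mulr_ge0// ltW.
  move: tauc; rewrite /tau mulrAC ltr_pdivlMr//; lra.
have [sm|sm] := leP (lambda * h) s0.
  have [||q1 q2 q3 q4] := small (lambda * h) => //.
    by rewrite mulr_ge0// ltW.
  have q5 : K * T * (5 * lambda `^ alpha * (lambda * h)) <= 1 / 8.
    by move: q4; rewrite /B -!mulrA.
  have := error_le_small_h R a b T alpha lambda K u0 ub f u hab hT halpha
    hlambda hK hsol M N U M0 N0 hU.1 eps eps0 trunc n n1 q1 q2 q3 q5 (ltnW Nn1) nN.
  move=> /le_trans; apply.
  rewrite [leLHS](_ : _ = S2 * `|C1| * (tau + h ^+ 3)); last exact: mulrA.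
  by apply: le_C; rewrite mulrDl; lra.
have Mm : (M < m)%N.
  rewrite ltnS truncn_ge_nat; last first.
    by rewrite divr_ge0 ?(ltW s00)// mulr_ge0// subr_ge0 ltW.
  move: sm; rewrite /h mulrA ltr_pdivlMr// => sm.
  by rewrite ler_pdivlMr// mulrC ltW.
apply: le_trans (fin M N Mm Nn1 M0 N0 U hU n nN) _.
by apply: le_C; rewrite mulrDl; lra.
Qed.
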